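(* Assume the following conditions (G1)–(G7), in the framework and notation of the context. (G1) $r:\Theta\to(0,\infty)$, $\theta\mapsto r_\theta$, is a positive measurable function, $\overline r$ is a positive number, $\Theta_0=\{\theta\in\Theta: r_\theta>\overline r\}$, and $\overline r$ is such that $\mathrm{Var}_\theta Y>0$ for all $\theta\in\Theta_0$. (G2) For all $\theta\in\Theta$ let $\mu_\theta=\mathbb{E}_\theta Y$, $\sigma_\theta^2=\mathrm{Var}_\theta Y$, and let $W=(Y-\mu_\theta)/\sigma_\theta$ whenever $\sigma_\theta>0$ and $W=0$ otherwise. $W'$ and $G$ are random variables such that for each $\theta\in\Theta_0$ the triple $(W,W',G)$ is a Stein coupling with respect to $\mathbb{P}_\theta$. (G3) With $D=W'-W$, $$\sup_{\theta\in\Theta_0} r_\theta\,\mathbb{E}_\theta\big|\mathbb{E}_\theta(1-GD\mid W)\big|<\infty\quad\text{and}\quad \sup_{\theta\in\Theta_0} r_\theta\,\mathbb{E}_\theta\{(1+|W|)\,|G|D^2\}<\infty .$$ (G4) For each $\theta\in\Theta_0$, $\mathcal{F}_\theta\subset\mathcal{F}$ is a sub-$\sigma$-algebra. $\overline G$ and $\overline D$ are random variables such that, for each $\theta\in\Theta_0$, $\overline G(\theta,\cdot)$ and $\overline D(\theta,\cdot)$ are $\mathcal{F}_\theta$-measurable and such that, on some event $F_{\theta,1}$ (which need not be in $\mathcal{F}_\theta$), $|G|\le\overline G$ and $|D|\le\overline D$, and $$\sup_{\theta\in\Theta_0} r_\theta^2\,\mathbb{E}_\theta\{|G|D^2(1-I_{F_{\theta,1}})\}<\infty\quad\text{and}\quad\sup_{\theta\in\Theta_0}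 r_\theta\,\mathbb{E}_\theta\{\overline G\,\overline D^2\}<\infty .$$ (G5) $\Psi$ is a $\Theta$-valued random element such that, for each $\theta\in\Theta_0$, $\Psi(\theta,\cdot)$ is $\mathcal{F}_\theta$-measurable. $V$ is a random variable, and for each $\theta\in\Theta_0$, $F_{\theta,2}\in\mathcal{F}_\theta$ is such that $$\mathbb{P}_\theta[V\in\cdot\mid\mathcal{F}_\theta](\omega)=\mathbb{P}_{\Psi(\theta,\omega)}[Y\in\cdot\,]\quad\text{for all }\omega\in F_{\theta,2},$$ and $$\sup_{\theta\in\Theta_0} r_\theta^2\,\mathbb{E}_\theta\{|G|D^2(1-I_{F_{\theta,2}})\}<\infty .$$ (G6) $\overline B$ is a random variable such that, for each $\theta\in\Theta_0$, $\overline B(\theta,\cdot)$ is $\mathcal{F}_\theta$-measurable, $$\sigma_\theta^{-1}|Y-V|\le\overline B\ \text{ on }F_{\theta,1},\quad\text{and}\quad\sup_{\theta\in\Theta_0} r_\theta^2\,\mathbb{E}_\theta\{\overline G\,\overline D^2\,\overline B\,I_{F_{\theta,2}}\}<\infty .$$ (G7) With essential suprema taken with respect to $\mathbb{P}_\theta$, $$\sup_{\theta\in\Theta_0}\ \operatorname*{ess\,sup}_{\omega\in F_{\theta,2}\cap\{\Psi(\theta,\cdot)\in\Theta_0\}}\frac{\sigma_\theta^2}{\sigma_{\Psi(\theta,\omega)}^2}<\infty,\qquad \sup_{\theta\in\Theta_0}\ \operatorname*{ess\,sup}_{\omega\in F_{\theta,2}}\frac{r_\theta}{r_{\Psi(\theta,\omega)}}<\infty,\qquad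 \sup_{\theta\in\Theta_0}\ \operatorname*{ess\,sup}_{\omega\in F_{\theta,2}\cap\{\Psi(\theta,\cdot)\in\Theta_0\}}\frac{r_{\Psi(\theta,\omega)}}{r_\theta}<\infty .$$ Then there exists a constant $C$, independent of $\theta$, such that $$\sup_{z\in\mathbb{R}}\big|\mathbb{P}_\theta[W\le z]-\mathbb{P}[Z\le z]\big|\le\frac{C}{r_\theta}\qquad\text{for all }\theta\in\Theta,$$ where $Z$ is a standard normal random variable.
   Context: Framework. $(\Theta,\mathcal{T})$ (parameter space) and $(\Omega,\mathcal{F})$ (sample space) are measurable spaces. All random variables are real-valued measurable functions on the product space $(\Theta\times\Omega,\mathcal{T}\otimes\mathcal{F})$; a $\Theta$-valued random element is a measurable map $\Theta\times\Omega\to\Theta$. A transition kernel $\theta\mapsto\mathbb{P}_\theta$ from $\Theta$ to $\Omega$ is given: for each $\theta\in\Theta$, $\mathbb{P}_\theta$ is a probability measure on $(\Omega,\mathcal{F})$, and for each $A\in\mathcal{F}$ the map $\theta\mapsto\mathbb{P}_\theta[A]$ is $\mathcal{T}$-measurable. For a random variable $X$, $\mathbb{E}_\theta X=\int_\Omega X(\theta,\omega)\,\mathbb{P}_\theta[d\omega]$, and its distribution under $\mathbb{P}_\theta$ is that of $X(\theta,\cdot)$; $\mathrm{Var}_\theta$ and conditional expectations are likewise with respect to $\mathbb{P}_\theta$. In particular $\mathbb{P}_{\theta'}[Y\in\cdot\,]$ is the law of $Y(\theta',\cdot)$ under $\mathbb{P}_{\theta'}$. Events such as $F_{\theta,1}$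 are elements of $\mathcal{F}$, and $I_F$ is the indicator of $F$. $Y$ is the (unstandardized) random variable of interest, with finite mean and variance under each $\mathbb{P}_\theta$. Stein coupling: a triple $(W,W',G)$ of random variables is a Stein coupling (with respect to a probability measure with expectation $\mathbb{E}$) if $\mathbb{E}\{Gf(W')-Gf(W)\}=\mathbb{E}\{Wf(W)\}$ for all functions $f$ for which these expectations exist.
   Formalization: The formal theorem additionally assumes that the bounding variables G-bar and B-bar are nonnegative everywhere for θ in Θ_0; without this they could be hugely negative off F_{θ,1}, which voids the moment bounds in (G4) and (G6) and makes the claim false. *)

(* Defs.v *)
From HB Require Import structures.
From mathcomp Require Import all_boot all_order all_algebra.
From mathcomp Require Import all_classical all_reals all_analysis.
From mathcomp Require Import measurable_realfun ess_sup_inf.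

Set Implicit Arguments.
Unset Strict Implicit.
Unset Printing Implicit Defensive.

Import Order.TTheory GRing.Theory Num.Theory.
Import numFieldNormedType.Exports.

Local Open Scope classical_set_scope.
Local Open Scope ring_scope.
Local Open Scope ereal_scope.

Definition sub_sigma_field d (T : measurableType d) (F : set (set T)) : Prop :=
  sigma_algebra [set: T] F /\ F `<=` measurable.

Definition measurable_wrt d d' (T : measurableType d) (T' : measurableType d')
    (F : set (set T)) (X : T -> T') : Prop :=
  g_sigma_algebra_preimage X `<=` F.

(* [E] is a version of the conditional expectation of [X] given [F]. The
   integrability of [X], which this notion presupposes, is part of it. *)
Definition is_cond_expectation d (T : measurableType d) (R : realType)
    (P : probability T R) (F : set (set T)) (X E : T -> R) : Prop :=
  [/\ P.-integrable [set: T] (EFin \o X),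
      measurable_wrt F E,
      P.-integrable [set: T] (EFin \o E) &
      forall A, F A ->
        \int[P]_(w in A) (E w)%:E = \int[P]_(w in A) (X w)%:E].

(* [K] is a regular version of the conditional distribution of [V] given [F]. *)
Definition is_cond_distribution d (T : measurableType d) (R : realType)
    (P : probability T R) (F : set (set T)) (V : T -> R)
    (K : T -> probability (measurableTypeR R) R) : Prop :=
  forall B : set (measurableTypeR R), measurable B ->
    measurable_wrt F (fun w => K w B) /\
    forall A, F A -> \int[P]_(w in A) K w B = P (A `&` V @^-1` B).

(* The test functions are the Borel functions for which both sides are
   expectations of integrable variables; [G * f W'] and [G * f W] need not be
   integrable separately. *)
Definition stein_coupling d (T : measurableType d) (R : realType)
    (P : probability T R) (W W' G : T -> R) : Prop :=
  forall f : R -> R, measurable_fun [set: R] f ->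
    P.-integrable [set: T]
      (fun w => (G w * f (W' w) - G w * f (W w))%:E) ->
    P.-integrable [set: T] (fun w => (W w * f (W w))%:E) ->
    'E_P[(fun w => G w * f (W' w) - G w * f (W w))%R]
      = 'E_P[(fun w => W w * f (W w))%R].

(* Essential supremum over [A]; it is [-oo] when [A] is negligible. *)
Definition ess_sup_on d (T : measurableType d) (R : realType)
    (P : probability T R) (A : set T) (f : T -> R) : \bar R :=
  ess_sup P (patch (cst -oo) A (EFin \o f)).

Section family.
Context d d' (Theta : measurableType d) (Omega : measurableType d').
Context (R : realType) (P : Theta -> probability Omega R).
Variable Y : Theta * Omega -> R.

Definition mean (t : Theta) : R := fine 'E_(P t)[(fun w => Y (t, w))].

Definition var (t : Theta) : R := fine 'V_(P t)[(fun w => Y (t, w))].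

Definition sdev (t : Theta) : R := Num.sqrt (var t).

Definition standardized (u : Theta * Omega) : R :=
  if (0 < sdev u.1)%R then ((Y u - mean u.1) / sdev u.1)%R else 0%R.

End family.

(* Main.v *)
Require Import Defs.
From HB Require Import structures.
From mathcomp Require Import all_boot all_order all_algebra.
From mathcomp Require Import all_classical all_reals all_analysis.
From mathcomp Require Import measurable_realfun ess_sup_inf.
From mathcomp Require Import ring lra.

(** Berry-Esseen bounds by induction over the parameter.

    Fix [t] with [r t > rbar], write [D = W' - W], and let [f] solve the Stein
    equation [f' x - x * f x = h x - E h(Z)] for a ramp [h] that falls from 1 to
    0 on [z, z + e].  The coupling identity gives
    [E h(W) - E h(Z) = E (f'(W) (1 - G D)) - E (G (f(W') - f(W) - D f'(W)))].
    In the first term [f'(W)] is bounded and known given [W], so [1 - G D] may be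
    replaced by its conditional expectation ([cond_expectation_pull_out]).  For
    the second, the mean value theorem turns the bracket into
    [D (f'(x) - f'(W))] with [x] between [W] and [W'], and [f'] varies for two
    reasons ([stein_remainder]): the smooth part costs [(1 + |W|) |G| D^2], and
    the ramp costs [|G| |D| min(1, |D| / e)] on the event that [W] is within
    [|D|] of [z, z + e].  These are collected in [stein_ramp_bound].

    The last cost would be [1 / (e r)], of order 1 for the wanted [e ~ 1 / r], if
    the event were ignored; so its probability has to be used.  On the good
    events [W] is close to the standardized [V], and conditionally on the sigma
    field [V] is distributed as [Y] under the parameter [Psi].  The probability
    that [Y] lies in an interval is at most twice its Kolmogorov distance to the
    normal plus the normalized length ([interval_of_kolmogorov]), that is, the
    quantity under study at another parameter [Psi], whose rate is comparable to
    [r t].  The window for [V] has random half-width [|Dbar| + Bbar]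
    ([conditional_window_bound]), which contributes to its length.  The part
    [Bbar] is paid for by the moment of [Gbar Dbar^2 Bbar]; the part [Dbar] would
    produce a third power of [Dbar], over which nothing is assumed, and it is
    here that the truncation [min(1, |D| / e)] matters: it trades [Dbar / e] for
    1 and leaves [Gbar Dbar^2].

    With [e = A / r t] this yields, for the distance [q t z] at level [z], a bound
    [C0 / r t] plus [O(1 / A)] times the supremum of [r q] over [r t]
    ([kolmogorov_one_step]).  For [A] large the factor is at most 1/2, so that a
    finite supremum is at most [2 * C0] ([le_of_halving]).  Finiteness is ensured
    by replacing [r] by [min(r, m)], which the argument tolerates with constants
    independent of [m]. *)

Set Implicit Arguments.
Unset Strict Implicit.
Unset Printing Implicit Defensive.

Import Order.TTheory GRing.Theory Num.Theory.
Import numFieldNormedType.Exports.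

Local Open Scope classical_set_scope.
Local Open Scope ring_scope.

(** * Weighted integrals and sets cut out by random intervals *)

Section weighted.
Context d d' (T : measurableType d) (T' : measurableType d') (R : realType).
Variable mu : {measure set T -> \bar R}.
Variables (phi : T -> T') (mphi : measurable_fun [set: T] phi).
Import HBNNSimple.
Local Open Scope ereal_scope.

Let integral_simple_weight (h : {nnsfun T' >-> R}) (c : T -> \bar R) :
  measurable_fun [set: T] c -> (forall w, 0 <= c w) ->
  \int[mu]_w ((h (phi w))%:E * c w) =
  \sum_(y \in range h) y%:E * \int[mu]_(w in phi @^-1` (h @^-1` [set y])) c w.
Proof.
move=> mc c0.
have mhp : measurable_fun [set: T] (fun w => h (phi w)).
  exact: measurableT_comp.
transitivity (\int[mu]_w (\sum_(y \in range h)
    (y * \1_(h @^-1` [set y]) (phi w))%:E * c w)).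
  apply: eq_integral => w _.
  rewrite -ge0_mule_fsuml => [|y]; last exact: nnfun_muleindic_ge0.
  by rewrite fsumEFin // -(fimfunE _ (phi w)).
rewrite ge0_integral_fsum//; last 2 first.
- move=> y; apply: emeasurable_funM => //.
  apply/measurable_EFinP; apply: measurable_funM => //.
  exact: (measurableT_comp (measurable_indic _)).
- by move=> y w _; rewrite mule_ge0// nnfun_muleindic_ge0.
apply: eq_fsbigr => y; rewrite inE => -[x _ xy].
have y0 : (0 <= y)%R by rewrite -xy.
have mA : measurable (phi @^-1` (h @^-1` [set y])).
  by rewrite -[X in measurable X]setTI; exact: mphi.
rewrite -ge0_integralZl_EFin//; last exact: measurable_funTS.
rewrite [RHS]integral_mkcond; apply: eq_integral => w _.
have wE : (phi w \in h @^-1` [set y]) = (w \in phi @^-1` (h @^-1` [set y])).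
  by apply/idP/idP; rewrite !inE.
by rewrite patchE indicE wE; case: ifPn => _; rewrite ?mulr1// mulr0 mul0e.
Qed.

Let integral_weight_lim (g : T' -> R) (mg : measurable_fun [set: T'] g)
    (c : T -> R) :
  measurable_fun [set: T] c -> (forall w, 0 <= c w)%R -> (forall x, 0 <= g x)%R ->
  let h := nnsfun_approx measurableT ((measurable_EFinP _ _).2 mg) in
  \int[mu]_w ((h n (phi w))%:E * (c w)%:E) @[n --> \oo] -->
  \int[mu]_w ((g (phi w))%:E * (c w)%:E).
Proof.
move=> mc c0 g0 h.
have gh w : (g (phi w))%:E * (c w)%:E = limn (fun n => (h n (phi w))%:E * (c w)%:E).
  apply/esym/cvg_lim => //; apply: cvgeZr => //.
  have := @cvg_nnsfun_approx _ _ _ _ measurableT _ ((measurable_EFinP _ _).2 mg).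
  by apply => // x _; rewrite lee_fin.
under [X in _ --> X]eq_integral do rewrite gh.
apply: cvg_monotone_convergence => //.
- move=> n; apply/measurable_EFinP/measurable_funM => //.
  exact: measurableT_comp.
- by move=> n w _; rewrite mule_ge0// lee_fin.
- move=> w _ m n mn; rewrite lee_wpmul2r ?lee_fin//.
  exact/lefP/nd_nnsfun_approx.
Qed.

(** A domination between [a] and [b] on every event described by [phi] extends
    from indicators of such events to all nonnegative weights [g \o phi], by
    monotone approximation with simple functions.  Conditional expectations are
    used through this property: for an identity in both directions, for a bound
    on conditional probabilities in one. *)
Lemma ge0_le_integral_weight (a b : T -> R) (g : T' -> R) :
  measurable_fun [set: T] a -> (forall w, 0 <= a w)%R ->
  measurable_fun [set: T] b -> (forall w, 0 <= b w)%R ->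
  (forall B, measurable B ->
     \int[mu]_(w in phi @^-1` B) (a w)%:E <= \int[mu]_(w in phi @^-1` B) (b w)%:E) ->
  measurable_fun [set: T'] g -> (forall x, 0 <= g x)%R ->
  \int[mu]_w ((g (phi w))%:E * (a w)%:E) <= \int[mu]_w ((g (phi w))%:E * (b w)%:E).
Proof.
move=> ma a0 mb b0 ab mg g0.
have ca := integral_weight_lim mg ma a0 g0.
have cb := integral_weight_lim mg mb b0 g0.
rewrite -(cvg_lim _ ca)// -(cvg_lim _ cb)//; apply: lee_lim.
- by apply/cvg_ex; eexists; exact: ca.
- by apply/cvg_ex; eexists; exact: cb.
apply: nearW => n; rewrite !integral_simple_weight//; do ?exact/measurable_EFinP.
apply: lee_fsum => //.
move=> y [x _ <-]; apply: lee_wpmul2l; first by rewrite lee_fin.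
apply: ab; exact: measurable_sfunP.
Qed.

End weighted.

Lemma measurable_indic_window d (T : measurableType d) (R : realType)
    (l r U : T -> R) :
  measurable_fun [set: T] l -> measurable_fun [set: T] r ->
  measurable_fun [set: T] U ->
  measurable_fun [set: T] (fun w => \1_`[l w, r w] (U w) : R).
Proof.
move=> ml mr mU.
have -> : (fun w => \1_`[l w, r w] (U w)) =
   \1_([set w | l w <= U w] `&` [set w | U w <= r w]) :> (T -> R).
  apply/funext => w; rewrite !indicE; congr (nat_of_bool _)%:R.
  by apply/idP/idP; rewrite !inE/= in_itv/= => /andP.
apply: measurable_indic; apply: measurableI.
  by rewrite -[X in measurable X]setTI; exact: measurable_fun_le.
by rewrite -[X in measurable X]setTI; exact: measurable_fun_le.
Qed.

Lemma measurable_sublevel d (T : measurableType d) (R : realType) (X : T -> R)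
    (z : R) :
  measurable_fun [set: T] X -> measurable [set w | X w <= z].
Proof.
move=> mX; have -> : [set w | X w <= z] = X @^-1` `]-oo, z]%classic.
  by apply/seteqP; split => w /=; rewrite in_itv.
by rewrite -[X in measurable X]setTI; apply: mX => //; exact: measurable_itv.
Qed.

(** * The standard Gaussian density and its tails *)

Section gaussian_density.
Context {R : realType}.
Implicit Types x y : R.
Local Notation mu := (@lebesgue_measure R).
Local Notation phi := (@normal_pdf R 0 1).

Lemma std_normal_pdfE x : phi x = normal_peak 1 * expR (- (x ^+ 2 / 2)).
Proof. by rewrite normal_pdfE// /normal_fun subr0 expr1n mulNr. Qed.

Lemma std_normal_pdf_gt0 x : 0 < phi x.
Proof. by rewrite std_normal_pdfE mulr_gt0 ?expR_gt0// normal_peak_gt0. Qed.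

Lemma std_normal_pdfN x : phi (- x) = phi x.
Proof. by rewrite !std_normal_pdfE sqrrN. Qed.

Lemma is_derive_half_sqr x : is_derive x 1 (fun y => y ^+ 2 / 2) x.
Proof.
have -> : (fun y : R => y ^+ 2 / 2) = (id ^+ 2) * cst 2^-1.
  by apply/funext => y.
apply: is_derive_eq; rewrite /= /GRing.scale /=; lra.
Qed.

Lemma is_derive_std_normal_pdf x : is_derive x 1 phi (- x * phi x).
Proof.
have -> : phi = cst (normal_peak 1) * (expR \o (- (fun y : R => y ^+ 2 / 2))).
  by apply/funext => y; rewrite std_normal_pdfE.
have := is_derive_half_sqr x.
move=> ?; apply: is_derive_eq; rewrite /= /GRing.scale /=.
rewrite !fctE/=; ring.
Qed.

Lemma cvg_std_normal_pdf : phi x @[x --> +oo] --> (0 : R).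
Proof.
rewrite -[X in _ --> X](mulr0 (@normal_peak R 1)).
under eq_fun do rewrite std_normal_pdfE.
apply: cvgM; first exact: cvg_cst.
apply: (@squeeze_cvgr _ _ _ _ (cst 0) (fun x => expR (- x))).
- near=> x; rewrite expR_ge0/= ler_expR lerN2 ler_pdivlMr// expr2.
  by rewrite ler_pM2l; near: x;
    [apply: nbhs_pinfty_ge|apply: nbhs_pinfty_gt]; exact: num_real.
- exact: cvg_cst.
- exact: cvgr_expR.
Unshelve. all: by end_near. Qed.

Lemma integrable_weighted_pdf (h : R -> R) : measurable_fun [set: R] h ->
  (forall x, 0 <= h x <= 1) ->
  mu.-integrable [set: R] (fun x => (h x * phi x)%:E).
Proof.
move=> mh h01; apply: le_integrable (integrable_normal_pdf 0 1) => //.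
  apply/measurable_EFinP/measurable_funM => //; exact: measurable_normal_pdf.
move=> x _; have /andP[h0 h1] := h01 x.
by rewrite !abse_EFin lee_fin normrM (ger0_norm h0) ler_piMl.
Qed.

(** Mills ratio: [- phi] is a primitive of [t * phi t], so that the integral of
    the latter beyond [x] is [phi x], and [t >= x] there. *)
Lemma mills_right x : 0 < x ->
  (x%:E * \int[mu]_(t in `[x, +oo[) (phi t)%:E <= (phi x)%:E)%E.
Proof.
move=> x0.
have mphi : measurable_fun [set: R] phi by exact: measurable_normal_pdf.
have -> : (phi x)%:E = (\int[mu]_(t in `[x, +oo[) (t * phi t)%:E)%E.
  have dN y : is_derive y 1 (- (phi : R -> R)) (y * phi y).
    have := is_derive_std_normal_pdf y; move=> ?.
    by apply: is_derive_eq; rewrite mulNr opprK.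
  rewrite (@ge0_continuous_FTC2y _ _ (- (phi : R -> R)) _ 0).
  - by rewrite -EFinB sub0r/= opprK.
  - by move=> y xy; rewrite mulr_ge0 ?normal_pdf_ge0// (le_trans _ xy)// ltW.
  - apply: continuous_subspaceT => y.
    by apply: cvgM; [exact: cvg_id|exact: continuous_normal_pdf].
  - rewrite -[X in _ --> X]oppr0; apply: cvgN; exact: cvg_std_normal_pdf.
  - by move=> y _; have [] := dN y.
  - apply: cvg_at_right_filter; apply: cvgN.
    exact: continuous_normal_pdf.
  - by move=> y _; rewrite derive1E; have := dN y => ?; rewrite derive_val.
rewrite -ge0_integralZl_EFin//; last 3 first.
- by move=> y _; rewrite lee_fin normal_pdf_ge0.
- exact/measurable_EFinP/measurable_funTS.
- exact: ltW.
apply: ge0_le_integral => //.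
- by move=> y _; rewrite -EFinM lee_fin mulr_ge0 ?normal_pdf_ge0 ?ltW.
- by apply/measurable_EFinP/measurable_funM => //; exact: measurable_funTS.
- by apply/measurable_EFinP/measurable_funM => //; exact: measurable_funTS.
- move=> y; rewrite /= in_itv/= andbT => xy.
  by rewrite -EFinM lee_fin ler_wpM2r// normal_pdf_ge0.
Qed.

Lemma mills_left x : 0 < x ->
  (x%:E * \int[mu]_(t in `]-oo, (- x)%R]) (phi t)%:E <= (phi x)%:E)%E.
Proof.
move=> x0; rewrite ge0_integration_by_substitutionNy; last 2 first.
- apply: continuous_subspaceT; exact: continuous_normal_pdf.
- by move=> y _; rewrite normal_pdf_ge0.
under eq_integral do rewrite /= std_normal_pdfN.
exact: mills_right.
Qed.

End gaussian_density.

(** * Solution of the Stein equation *)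

Section stein_equation.
Context {R : realType}.
Implicit Types (x y : R) (h : R -> R).
Local Notation mu := (@lebesgue_measure R).
Local Notation phi := (@normal_pdf R 0 1).

(** [E h(Z)] for a standard normal [Z]. *)
Definition gauss_mean h : R := (\int[mu]_t (h t * phi t))%R.

(** [E (h(Z); Z <= x)]. *)
Definition gauss_partial h x : R := (\int[mu]_(t in `]-oo, x]) (h t * phi t))%R.

Let stdcdf x : R := gauss_partial (cst 1) x.

Definition test_fun h := continuous h /\ forall x, 0 <= h x <= 1.

Lemma integrable_test_pdf h (D : set R) : test_fun h -> measurable D ->
  mu.-integrable D (EFin \o (fun t => h t * phi t)).
Proof.
move=> [ch h01] mD; apply: (@integrableS _ _ _ _ setT) => //.
by apply: integrable_weighted_pdf => //; exact: continuous_measurable_fun.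
Qed.

Lemma test_fun1 : test_fun (cst 1).
Proof. by split=> [x|x]; [exact: cvg_cst|rewrite ler01 lexx]. Qed.

Lemma test_funC h : test_fun h -> test_fun (fun x => 1 - h x).
Proof.
move=> [ch h01]; split=> x; last by have := h01 x; lra.
by apply: cvgB; [exact: cvg_cst|exact: ch].
Qed.

Lemma gauss_partialC h x : test_fun h ->
  gauss_partial (fun t => 1 - h t) x = stdcdf x - gauss_partial h x.
Proof.
move=> th; rewrite /stdcdf /gauss_partial -RintegralB//; last 2 first.
- exact: integrable_test_pdf test_fun1 _.
- exact: integrable_test_pdf.
by apply: eq_Rintegral => t _; rewrite mulrBl.
Qed.

Lemma gauss_meanC h : test_fun h ->
  gauss_mean (fun t => 1 - h t) = 1 - gauss_mean h.
Proof.
move=> th; rewrite /gauss_mean.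
have E1 : 1 = (\int[mu]_t (1 * phi t))%R :> R.
  rewrite /Rintegral; under eq_integral do rewrite mul1r.
  by rewrite integral_normal_pdf.
rewrite [X in X - _]E1 -RintegralB//; last 2 first.
- exact: integrable_test_pdf test_fun1 _.
- exact: integrable_test_pdf.
by apply: eq_Rintegral => t _; rewrite mulrBl.
Qed.

Lemma gauss_partial_ge0 h x : test_fun h -> 0 <= gauss_partial h x.
Proof.
move=> [_ h01]; apply: Rintegral_ge0 => t _.
by rewrite mulr_ge0 ?normal_pdf_ge0//; have /andP[] := h01 t.
Qed.

Lemma gauss_partial_le_mean h x : test_fun h -> gauss_partial h x <= gauss_mean h.
Proof.
move=> th; have [ch h01] := th.
have iT := integrable_test_pdf th (@measurableT _ _).

apply: fine_le.
- by apply: integrable_fin_num => //; exact: integrable_test_pdf.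
- by apply: integrable_fin_num.
- apply: ge0_subset_integral => //; first by have /integrableP[] := iT.
  by move=> t _; rewrite lee_fin mulr_ge0 ?normal_pdf_ge0//; have /andP[] := h01 t.
Qed.

Lemma stdcdf_tail x : 1 - stdcdf x = fine (\int[mu]_(t in `]x, +oo[) (phi t)%:E).
Proof.
have i1 D mD := @integrable_test_pdf _ D test_fun1 mD.
have E1 : 1 = (\int[mu]_t (cst 1 t * phi t))%R :> R.
  rewrite /Rintegral; under eq_integral do rewrite mul1r.
  by rewrite integral_normal_pdf.
rewrite {1}E1 -(itv_setU_setT false x) Rintegral_setU//; last 2 first.
- by apply: i1; rewrite itv_setU_setT.
- exact: disjoint_rays.
rewrite /stdcdf /gauss_partial addrAC subrr add0r /Rintegral.
by under eq_integral do rewrite mul1r.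
Qed.

(** As [h] and [1 - h] are both nonnegative, the numerator of the solution is at
    most [stdcdf x * (1 - stdcdf x)], and hence at most either tail. *)
Lemma stein_numerator h x : test_fun h ->
  `|gauss_partial h x - gauss_mean h * stdcdf x| <= stdcdf x /\
  `|gauss_partial h x - gauss_mean h * stdcdf x| <= 1 - stdcdf x.
Proof.
move=> th; have th' := test_funC th.
have := gauss_partial_ge0 x th; have := gauss_partial_ge0 x th'.
have := gauss_partial_le_mean x th; have := gauss_partial_le_mean x th'.
rewrite gauss_partialC// gauss_meanC//.
set H := gauss_partial h x; set N := gauss_mean h; set c := stdcdf x.
move=> h1 h2 h3 h4.
have c0 : 0 <= c by lra.
have c1 : c <= 1 by lra.
by rewrite !ler_norml; split; apply/andP; split; nra.
Qed.

(** The bounded solution of [f' x - x * f x = h x - gauss_mean h], obtained from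
    the integrating factor [phi]. *)
Definition stein_sol h x : R := (gauss_partial h x - gauss_mean h * stdcdf x) / phi x.

Lemma gauss_partial_derive h x : test_fun h ->
  is_derive x 1 (gauss_partial h) (h x * phi x).
Proof.
move=> th; have [ch h01] := th.
have xx : x < x + 1 by rewrite ltrDl.
have [] := @continuous_FTC1 R (fun t => h t * phi t) -oo%O x (x + 1) xx.
- exact: integrable_test_pdf.
- by rewrite ltNyr.
- by apply: cvgM; [exact: ch|exact: continuous_normal_pdf].
by move=> d1 d2; apply: DeriveDef; [exact: d1|rewrite -derive1E].
Qed.

Lemma stein_sol_derive h x : test_fun h ->
  is_derive x 1 (stein_sol h) (x * stein_sol h x + h x - gauss_mean h).
Proof.
move=> th; have d1 := gauss_partial_derive x th.
have d2 := gauss_partial_derive x test_fun1.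
have d3 := is_derive_std_normal_pdf x.
have phi0 := std_normal_pdf_gt0 x.
have phin0 : phi x != 0 by rewrite gt_eqF.
have -> : stein_sol h = (gauss_partial h - cst (gauss_mean h) * gauss_partial (cst 1))
   * (fun y => (phi y)^-1).
  by apply/funext => y.
have d4 := is_deriveV phin0 d3.
apply: is_derive_eq; rewrite /stein_sol /= /GRing.scale /= !fctE /=.
by field.
Qed.

(** A common bound for all the solutions: the Mills ratio bounds them by 1 for
    [|x| >= 1], and [1 / phi] bounds them by [1 / phi 1] for [|x| <= 1]. *)
Definition stein_const : R := 1 + (phi 1)^-1.

(** The numerator is bounded by the tail on the side of [x], and the Mills ratio
    of that tail is at most [1 / |x|]. *)
Lemma stein_sol_mulx h x : test_fun h -> `|x * stein_sol h x| <= 1.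
Proof.
move=> th; have [b1 b2] := stein_numerator x th.
have phi0 := std_normal_pdf_gt0 x.
rewrite /stein_sol mulrA normrM [X in _ * X]ger0_norm ?invr_ge0 ?(ltW phi0)//.
rewrite ler_pdivrMr// mul1r normrM.
have fin (D : set R) : measurable D -> (\int[mu]_(t in D) (phi t)%:E)%E \is a fin_num.
  move=> mD; apply: integrable_fin_num => //.
  apply: eq_integrable (integrable_test_pdf test_fun1 mD) => // t _.
  by rewrite /= mul1r.
have [x0|x0|x0] := ltgtP x 0; last first.
- by apply: le_trans (ltW phi0); rewrite {1}x0 normr0 mul0r.
- have M := mills_right x0.
  rewrite gtr0_norm//; apply: (le_trans (ler_wpM2l (ltW x0) b2)).
  rewrite stdcdf_tail -lee_fin EFinM fineK ?fin//.
  by rewrite integral_itv_obnd_cbnd//; apply/measurable_EFinP/measurable_funTS;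
    exact: measurable_normal_pdf.
- have Nx0 : 0 < - x by rewrite oppr_gt0.
  have := mills_left Nx0; rewrite opprK std_normal_pdfN => M.
  rewrite ltr0_norm//; apply: (le_trans (ler_wpM2l (ltW Nx0) b1)).
  rewrite -lee_fin; apply: le_trans M; rewrite EFinM /stdcdf /gauss_partial.
  rewrite /Rintegral; under eq_integral do rewrite mul1r.
  by rewrite fineK// fin.
Qed.

Lemma stein_sol_bound h x : test_fun h -> `|stein_sol h x| <= stein_const.
Proof.
move=> th; have [x1|x1] := leP 1 `|x|.
  apply: (@le_trans _ _ `|x * stein_sol h x|).
    by rewrite [leRHS]normrM ler_peMl.
  apply: (le_trans (stein_sol_mulx x th)).
  by rewrite /stein_const lerDl invr_ge0 ltW// std_normal_pdf_gt0.
have [b1 b2] := stein_numerator x th.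
have phi0 := std_normal_pdf_gt0 x.
rewrite /stein_sol normrM [X in _ * X]ger0_norm ?invr_ge0 ?(ltW phi0)//.
have p1 := @std_normal_pdf_gt0 R 1.
have p1x : phi 1 <= phi x.
  rewrite !std_normal_pdfE ler_pM2l ?normal_peak_gt0// ler_expR lerN2.
  rewrite ler_pM2r// -(real_normK (num_real x)) expr1n.
  by rewrite exprn_ile1// ltW.
apply: (@le_trans _ _ (1 * (phi 1)^-1)); last by rewrite /stein_const mul1r lerDr.
apply: ler_pM => //; first by rewrite invr_ge0 ltW.
  apply: (le_trans b2); rewrite gerBl; exact: gauss_partial_ge0 test_fun1.
by rewrite lef_pV2 ?posrE.
Qed.

End stein_equation.

(** * Ramps as smoothed indicators *)

Section ramp.
Context {R : realType}.
Implicit Types (x y z e d : R).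
Local Notation mu := (@lebesgue_measure R).
Local Notation phi := (@normal_pdf R 0 1).

(** Equal to 1 up to [z], to 0 from [z + e] on, and affine in between. *)
Definition ramp z e x : R := Num.max 0 (Num.min 1 ((z + e - x) / e)).

Lemma test_fun_ramp z e : test_fun (ramp z e).
Proof.
split=> x; last first.
  by rewrite /ramp le_max lexx/= ge_max ler01/= ge_min lexx.
apply: (@continuous_max R R (cst 0) _ x); first exact: cvg_cst.
apply: (@continuous_min R R (cst 1) _ x); first exact: cvg_cst.
apply: cvgM; last exact: cvg_cst.
by apply: cvgB; [exact: cvg_cst|exact: cvg_id].
Qed.

Lemma ramp_eq1 z e x : 0 < e -> x <= z -> ramp z e x = 1.
Proof.
move=> e0 xz; rewrite /ramp (min_idPl _) ?(max_idPr _)//.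
by rewrite ler_pdivlMr// mul1r; lra.
Qed.

Lemma ramp_eq0 z e x : 0 < e -> z + e <= x -> ramp z e x = 0.
Proof.
move=> e0 xz; rewrite /ramp (max_idPl _)// ge_min; apply/orP; right.
by rewrite ler_pdivrMr// mul0r; lra.
Qed.

Lemma ramp_le1 z e x : ramp z e x <= 1.
Proof. by have [_ /(_ x)/andP[]] := test_fun_ramp z e. Qed.

Lemma ramp_ge0 z e x : 0 <= ramp z e x.
Proof. by have [_ /(_ x)/andP[]] := test_fun_ramp z e. Qed.

Lemma ramp_lipschitz z e x y : 0 < e ->
  `|ramp z e y - ramp z e x| <= Num.min 1 (`|y - x| / e).
Proof.
move=> e0; wlog xy : x y / x <= y => [hw|].
  have [|/ltW] := leP x y; first exact: hw.
  by move=> /hw; rewrite distrC (distrC x).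
have Eu : (z + e - x) / e - (z + e - y) / e = `|y - x| / e.
  by rewrite ger0_norm ?subr_ge0// -mulrBl; congr (_ / _); ring.
have v0 : 0 <= `|y - x| / e by rewrite divr_ge0// ltW.
move: Eu v0; rewrite /ramp; set u := (z + e - x) / e; set v := (z + e - y) / e.
set t := `|y - x| / e => uv t0.
rewrite le_min; apply/andP; split; rewrite ler_norml;
rewrite /Num.min /Num.max; do !case: ifPn; rewrite -?leNgt; move=> *;
apply/andP; split; lra.
Qed.

(** If [x] is further than [d] from the sloping part, then [y] is on the same
    side of it as [x], where the ramp is constant.  Keeping both 1 and [d / e] in the
    minimum matters later, when [d] is not small compared with [e]. *)
Lemma ramp_local z e x y d : 0 < e -> `|y - x| <= d ->
  `|ramp z e y - ramp z e x| <=
    Num.min 1 (d / e) * (\1_`[z - d, z + e + d] x).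
Proof.
move=> e0 yxd; have d0 := le_trans (normr_ge0 _) yxd.
move: (yxd); rewrite ler_norml => /andP[y1 y2].
rewrite indicE; case: (boolP (x \in _)) => [_|].
  rewrite mulr1; apply: (le_trans (ramp_lipschitz _ _ _ e0)).
  by rewrite le_min !ge_min lexx/= ler_pM2r ?invr_gt0// yxd orbT.
rewrite mulr0 notin_setE/= in_itv/= => /negP; rewrite negb_and -!ltNge => /orP[xz|xz].
  by rewrite !ramp_eq1 ?subrr ?normr0//; lra.
by rewrite !ramp_eq0 ?subrr ?normr0//; lra.
Qed.

Definition gauss_cdf z : R := fine (normal_prob 0 1 `]-oo, z]).

Lemma normal_peak_le1 : normal_peak (1 : R) <= 1.
Proof.
rewrite /normal_peak invf_le1 ?sqrtr_gt0.
  rewrite -{1}sqrtr1 ler_wsqrtr// expr1n mul1r.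
  have := @pi_ge2 R; lra.
have := @pi_gt0 R; lra.
Qed.

Lemma normal_prob_fin (D : set R) : measurable D ->
  normal_prob 0 1 D = (fine (normal_prob (0 : R) 1 D))%:E.
Proof. by move=> mD; rewrite fineK// fin_num_measure. Qed.

(** The density is bounded by 1. *)
Lemma gauss_cdf_lipschitz z e : 0 < e -> gauss_cdf (z + e) <= gauss_cdf z + e.
Proof.
move=> e0; rewrite -lee_fin EFinD /gauss_cdf -!normal_prob_fin//.
have -> : `]-oo, (z + e)]%classic = `]-oo, z] `|` `]z, (z + e)] :> set R.
  by rewrite -itv_bndbnd_setU// bnd_simp lerDl ltW.
apply: (le_trans (measureU2 _ _ _)) => //; apply: leeD => //.
apply: (@le_trans _ _ (\int[mu]_(t in `]z, (z + e)%R]) (cst 1 t))%E).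
  apply: ge0_le_integral => //.
  - by move=> t _; rewrite lee_fin normal_pdf_ge0.
  - by apply/measurable_EFinP/measurable_funTS; exact: measurable_normal_pdf.
  - move=> t _; rewrite lee_fin; apply: le_trans normal_peak_le1.
    exact: normal_pdf_ub.
rewrite integral_cst//= mul1e lebesgue_measure_itv/= lte_fin ltrDl e0.
by rewrite -EFinB addrAC subrr add0r.
Qed.

Lemma gauss_mean_ramp z e : 0 < e ->
  gauss_cdf z <= gauss_mean (ramp z e) <= gauss_cdf (z + e).
Proof.
move=> e0; have th := test_fun_ramp z e.
have iT := integrable_test_pdf th (@measurableT _ _).
have -> : gauss_mean (ramp z e) =
    fine (\int[mu]_(t in setT) (ramp z e t * phi t)%:E) by [].
have r0 t : 0 <= ramp z e t * phi t by rewrite mulr_ge0 ?ramp_ge0 ?normal_pdf_ge0.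
have mr : measurable_fun [set: R] (fun t => (ramp z e t * phi t)%:E).
  by have /integrableP[] := iT.
have Ifin := integrable_fin_num (@measurableT _ _) iT.
rewrite -!lee_fin (fineK Ifin).
rewrite /gauss_cdf -!normal_prob_fin//; apply/andP; split.
  rewrite (@le_trans _ _ (\int[mu]_(t in `]-oo, z]) (ramp z e t * phi t)%:E)%E)//.
    rewrite /normal_prob; apply: ge0_le_integral => //.
    - by move=> t _; rewrite lee_fin normal_pdf_ge0.
    - by apply/measurable_EFinP/measurable_funTS; exact: measurable_normal_pdf.
    - exact: measurable_funTS.
    - by move=> t; rewrite /= in_itv/= => tz; rewrite ramp_eq1// mul1r.
  by apply: ge0_subset_integral => // t _; rewrite lee_fin.
rewrite /normal_prob [leRHS]integral_mkcond.
apply: ge0_le_integral => //.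
- by move=> t _; rewrite lee_fin.
- apply/(measurable_restrictT _ _).1 => //; apply/measurable_EFinP/measurable_funTS.
  exact: measurable_normal_pdf.
- move=> t _; rewrite patchE; case: ifPn.
    by move=> _; rewrite lee_fin ler_piMl ?ramp_le1// normal_pdf_ge0.
  rewrite notin_setE/= in_itv/= => /negP; rewrite -ltNge => /ltW tz.
  by rewrite ramp_eq0// mul0r.
Qed.

End ramp.

(** * Pulling a known factor out of a conditional expectation *)

Section pull_out.
Context d (T : measurableType d) (R : realType) (P : probability T R).
Implicit Types (X E : T -> R).

Lemma integrable_measurable X : P.-integrable [set: T] (EFin \o X) ->
  measurable_fun [set: T] X.
Proof. by move=> /integrableP[/measurable_EFinP]. Qed.

Lemma integrableRD (X E : T -> R) : P.-integrable [set: T] (EFin \o X) ->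
  P.-integrable [set: T] (EFin \o E) ->
  P.-integrable [set: T] (EFin \o (fun w => X w + E w)).
Proof. by move=> iX iE; have := integrableD measurableT iX iE. Qed.

Lemma integrableRB (X E : T -> R) : P.-integrable [set: T] (EFin \o X) ->
  P.-integrable [set: T] (EFin \o E) ->
  P.-integrable [set: T] (EFin \o (fun w => X w - E w)).
Proof. by move=> iX iE; have := integrableB measurableT iX iE. Qed.

Lemma integrableRZ (a : R) X : P.-integrable [set: T] (EFin \o X) ->
  P.-integrable [set: T] (EFin \o (fun w => a * X w)).
Proof. by move=> iX; have := @integrableZl _ _ _ P _ measurableT a _ iX. Qed.

Lemma integrable_bounded (g X : T -> R) (M : R) :
  measurable_fun [set: T] g -> (forall w, `|g w| <= M) ->
  P.-integrable [set: T] (EFin \o X) ->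
  P.-integrable [set: T] (EFin \o (fun w => g w * X w)).
Proof.
move=> mg gM iX; apply: (@le_integrable _ _ _ _ _ _ _ (EFin \o (fun w => M * X w))) => //.
- by apply/measurable_EFinP/measurable_funM => //; exact: integrable_measurable.
- move=> w _; rewrite /= lee_fin !normrM ler_wpM2r//.
  exact: le_trans (gM w) (ler_norm _).
- exact: integrableRZ.
Qed.

(** Shifting by [s = |X| + |E|] and by [M] makes the integrands and the weight
    nonnegative; then [ge0_le_integral_weight] applies in both directions, and
    the shifts cancel by linearity. *)
Lemma cond_expectation_pull_out (W X E : T -> R) (g : R -> R) (M : R) :
  measurable_fun [set: T] W ->
  is_cond_expectation P (g_sigma_algebra_preimage W) X E ->
  measurable_fun [set: R] g -> (forall x, `|g x| <= M) ->
  (\int[P]_w (g (W w) * X w) = \int[P]_w (g (W w) * E w))%R.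
Proof.
move=> mW [iX _ iE XE] mg gM.
have mX := integrable_measurable iX; have mE := integrable_measurable iE.
have gM0 x : 0 <= g x + M.
  by have := gM x; rewrite ler_norml => /andP[]; lra.
have gM2 w : `|g (W w) + M| <= M + M.
  by rewrite ger0_norm// lerD2r (le_trans (ler_norm _)).
have mgW : measurable_fun [set: T] (g \o W) by exact: measurableT_comp.
have mgWM : measurable_fun [set: T] (fun w => g (W w) + M) by exact: measurable_funD.
pose s w := `|X w| + `|E w|.
have iXn : P.-integrable [set: T] (EFin \o (fun w => `|X w|)) by exact: integrable_norm.
have iEn : P.-integrable [set: T] (EFin \o (fun w => `|E w|)) by exact: integrable_norm.
have is_ : P.-integrable [set: T] (EFin \o s) by exact: integrableRD.
have isX : P.-integrable [set: T] (EFin \o (fun w => s w + X w)) by exact: integrableRD.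
have isE : P.-integrable [set: T] (EFin \o (fun w => s w + E w)) by exact: integrableRD.
have sX0 w : 0 <= s w + X w.
  by rewrite /s; have := ler_norm (- X w); rewrite normrN; have := normr_ge0 (E w); lra.
have sE0 w : 0 <= s w + E w.
  by rewrite /s; have := ler_norm (- E w); rewrite normrN; have := normr_ge0 (X w); lra.
have eqB B : measurable B ->
    (\int[P]_(w in W @^-1` B) (s w + X w)%:E = \int[P]_(w in W @^-1` B) (s w + E w)%:E)%E.
  move=> mB; have mWB : measurable (W @^-1` B).
    by rewrite -[X in measurable X]setTI; exact: mW.
  have sub Z : P.-integrable [set: T] (EFin \o Z) ->
      P.-integrable (W @^-1` B) (EFin \o Z).
    by apply: integrableS.
  under eq_integral do rewrite EFinD.
  under [RHS]eq_integral do rewrite EFinD.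
  rewrite integralD//; [|exact: sub|exact: sub].
  rewrite integralD//; [|exact: sub|exact: sub].
  by rewrite -XE//; exists B => //; rewrite setTI.
have key : (\int[P]_w ((g (W w) + M) * (s w + X w)) =
            \int[P]_w ((g (W w) + M) * (s w + E w)))%R.
  congr fine; apply/eqP; rewrite eq_le; apply/andP; split;
    under eq_integral do rewrite EFinM; under [leRHS]eq_integral do rewrite EFinM;
    apply: (@ge0_le_integral_weight _ _ _ _ _ P W mW _ _ (fun x => g x + M)) => //;
    do ?[exact: integrable_measurable | exact: measurable_funD |
         by move=> B mB; rewrite eqB].
have split_ Z : P.-integrable [set: T] (EFin \o Z) ->
    (\int[P]_w ((g (W w) + M) * (s w + Z w)) =
     \int[P]_w ((g (W w) + M) * s w) + \int[P]_w (g (W w) * Z w) + M * \int[P]_w Z w)%R.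
  move=> iZ.
  have i1 := integrable_bounded mgWM gM2 is_.
  have i2 := integrable_bounded mgW (fun w => gM (W w)) iZ.
  have i3 : P.-integrable [set: T] (EFin \o (fun w => M * Z w)).
    exact: integrableRZ.
  rewrite -RintegralZl// -RintegralD// -RintegralD//; last exact: integrableRD.
  by apply: eq_Rintegral => w _; ring.
have := key; rewrite !split_//.
have -> : (\int[P]_w E w = \int[P]_w X w)%R.
  by congr fine; apply: XE; exists setT => //; rewrite setTI.
by move=> /addIr/addrI.
Qed.

End pull_out.

(** * Stein's method for a ramp *)

Section stein_ramp.
Context {R : realType}.
Implicit Types (x y z e : R).

Lemma mean_value (f df : R -> R) x y : (forall t : R, is_derive t 1 f (df t)) ->
  exists2 t, `|t - x| <= `|y - x| & f y - f x = df t * (y - x).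
Proof.
move=> fd.
have cf a b : {within `[a, b], continuous f}.
  by apply: derivable_within_continuous => t _; case: (fd t).
have [xy|/ltW yx] := leP x y.
  have [t] := MVT_segment xy (fun t _ => fd t) (cf x y).
  rewrite in_itv/= => /andP[xt ty] ->; exists t => //.
  by rewrite !ger0_norm ?subr_ge0//; lra.
have [t] := MVT_segment yx (fun t _ => fd t) (cf y x).
rewrite in_itv/= => /andP[xt ty] E; exists t; last by lra.
by rewrite !ler0_norm ?subr_le0//; lra.
Qed.

Variables (z e : R) (e0 : 0 < e).
Let h := ramp z e.
Let th : test_fun h := test_fun_ramp z e.
Let f := stein_sol h.
Let N := gauss_mean h.
(** The derivative of the solution for the ramp, as the equation gives it. *)
Definition stein_sol_deriv x :=
  x * stein_sol (ramp z e) x + ramp z e x - gauss_mean (ramp z e).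
Let f' := stein_sol_deriv.

Let c : R := stein_const.

Lemma stein_const_ge1 : 1 <= stein_const :> R.
Proof. by rewrite /stein_const lerDl invr_ge0 ltW// std_normal_pdf_gt0. Qed.

Lemma gauss_mean_01 : 0 <= N <= 1.
Proof.
have := gauss_mean_ramp z e0; rewrite -/h -/N => /andP[a b].
apply/andP; split; first by apply: le_trans a; rewrite fine_ge0.
apply: (le_trans b); rewrite -lee_fin -normal_prob_fin//.
exact: probability_le1.
Qed.

Lemma stein_sol_deriv_bound x : `|f' x| <= 2.
Proof.
rewrite /f' /stein_sol_deriv -/h -/N.
have := stein_sol_mulx x th; rewrite !ler_norml => /andP[a b].
have := ramp_ge0 z e x; have := ramp_le1 z e x; rewrite -/h => h0 h1.
by have := gauss_mean_01; move=> /andP[n0 n1]; apply/andP; split; lra.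
Qed.

Lemma stein_sol_lipschitz x y : `|f y - f x| <= 2 * `|y - x|.
Proof.
have [t _ ->] := @mean_value f f' x y (fun t => stein_sol_derive t th).
by rewrite normrM ler_wpM2r// stein_sol_deriv_bound.
Qed.

(** A bound for [d] times the variation of the ramp when its argument moves by at
    most [d] from [w]; of order [d ^+ 2 / e] for small [d], but only [d] for
    large [d], and zero unless [w] is near the sloping part. *)
Definition clipped_move (d w : R) : R :=
  d * Num.min 1 (d / e) * \1_`[z - d, z + e + d] w.

(** By the mean value theorem the left-hand side is [|y - x|] times a variation of
    [f'].  The equation splits [f' t] into [t * f t], which is locally Lipschitz
    with constant [O(1 + |x|)] at [x], and the ramp. *)
Lemma stein_remainder x y :
  `|f y - f x - (y - x) * f' x| <=
    2 * c * ((1 + `|x|) * (y - x) ^+ 2) + clipped_move `|y - x| x.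
Proof.
have [t tx ->] := @mean_value f f' x y (fun t => stein_sol_derive t th).
have -> : f' t * (y - x) - (y - x) * f' x = (y - x) * (f' t - f' x) by ring.
rewrite normrM -(real_normK (num_real (y - x))) expr2.
have E : f' t - f' x = (t - x) * f t + x * (f t - f x) + (h t - h x).
  by rewrite /f' /stein_sol_deriv -/h -/f; ring.
have a1 : `|(t - x) * f t| <= c * `|y - x|.
  by rewrite normrM mulrC ler_pM// stein_sol_bound.
have a2 : `|x * (f t - f x)| <= 2 * (`|x| * `|y - x|).
  rewrite normrM mulrCA ler_wpM2l//.
  by apply: (le_trans (stein_sol_lipschitz _ _)); rewrite ler_wpM2l.
have a3 := ramp_local z e0 tx; rewrite -/h in a3.
have c1 : 1 <= c := stein_const_ge1.
rewrite /clipped_move -[X in _ <= _ + X]mulrA.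
set dd := `|y - x| in a1 a2 a3 *.
set I := Num.min 1 (dd / e) * _ in a3 *.
have d0 : 0 <= dd by exact: normr_ge0.
have x0 := normr_ge0 x.
have : `|f' t - f' x| <= c * dd + 2 * (`|x| * dd) + I.
  by rewrite E (le_trans (ler_normD _ _))// lerD// (le_trans (ler_normD _ _))// lerD.
move=> /(ler_wpM2l d0)/le_trans; apply.
rewrite mulrDr lerD2r.
have xdd : 0 <= `|x| * (dd * dd) by rewrite !mulr_ge0.
have dd2 : 0 <= dd * dd by rewrite mulr_ge0.
nra.
Qed.

End stein_ramp.

Section stein_bound.
Context d (T : measurableType d) (R : realType) (P : probability T R).
Variables (W W' G E : T -> R) (z e : R).
Hypotheses (mW : measurable_fun [set: T] W) (mW' : measurable_fun [set: T] W')
  (mG : measurable_fun [set: T] G) (e0 : 0 < e).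
Let D w := W' w - W w.
Hypothesis WG : stein_coupling P W W' G.
Hypothesis EX : is_cond_expectation P (g_sigma_algebra_preimage W)
  (fun w => 1 - G w * D w) E.
Hypothesis int3 : P.-integrable [set: T]
  (EFin \o (fun w => (1 + `|W w|) * (`|G w| * D w ^+ 2))).

Lemma measurable_clipped_move (U V : T -> R) : measurable_fun [set: T] U ->
  measurable_fun [set: T] V ->
  measurable_fun [set: T] (fun w => clipped_move z e (U w) (V w)).
Proof.
move=> mU mV; apply: measurable_funM.
  apply: measurable_funM => //; apply: measurable_minr => //.
  exact: measurable_funM.
apply: measurable_indic_window => //; first exact: measurable_funB.
exact: measurable_funD.
Qed.

Let mD : measurable_fun [set: T] D.
Proof. exact: measurable_funB. Qed.

Lemma clipped_move_le dd w : 0 <= dd -> 0 <= clipped_move z e dd w <= dd ^+ 2 / e.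
Proof.
move=> d0; rewrite /clipped_move; have q0 : 0 <= dd / e by rewrite divr_ge0// ltW.
have m0 : 0 <= Num.min 1 (dd / e) by rewrite le_min ler01.
have m1 : Num.min 1 (dd / e) <= dd / e by rewrite ge_min lexx orbT.
have dm : dd * Num.min 1 (dd / e) <= dd ^+ 2 / e by rewrite expr2 -mulrA ler_wpM2l.
have dm0 : 0 <= dd * Num.min 1 (dd / e) by rewrite mulr_ge0.
by rewrite indicE; case: (_ \in _); rewrite ?mulr1 ?mulr0 ?dm0 ?lexx//
  divr_ge0 ?sqr_ge0// ltW.
Qed.

Lemma integrable_clipped : P.-integrable [set: T]
  (EFin \o (fun w => `|G w| * clipped_move z e `|D w| (W w))).
Proof.
apply: le_integrable (integrableRZ e^-1 int3) => //.
  apply/measurable_EFinP/measurable_funM; first exact: measurableT_comp.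
  by apply: measurable_clipped_move => //; exact: measurableT_comp.
move=> w _; have /andP[c0 cle] := clipped_move_le (W w) (normr_ge0 (D w)).
rewrite /= lee_fin [leLHS]ger0_norm; last exact: mulr_ge0.
apply: le_trans (ler_norm _); apply: (@le_trans _ _ (`|G w| * (`|D w| ^+ 2 / e))).
  by rewrite ler_wpM2l.
rewrite real_normK ?num_real// mulrA [leRHS]mulrC ler_pM2r ?invr_gt0//.
by apply: ler_peMl; [rewrite mulr_ge0 ?sqr_ge0|rewrite lerDl].
Qed.

(** Applying the coupling to the solution [f], and comparing [f(W') - f(W)] with
    [(W' - W) f'(W)].  The remainder estimate provides the integrability that the
    coupling demands of [G * f(W') - G * f(W)], which is known for neither of the
    two terms alone. *)
Lemma stein_ramp_bound :
  `| (\int[P]_w ramp z e (W w))%R - gauss_mean (ramp z e) | <=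
   2 * (\int[P]_w `|E w|)%R
   + 2 * stein_const * (\int[P]_w ((1 + `|W w|) * (`|G w| * D w ^+ 2)))%R
   + (\int[P]_w (`|G w| * clipped_move z e `|D w| (W w)))%R.
Proof.
have th := test_fun_ramp z e; have [ch h01] := th.
pose f := stein_sol (ramp z e); pose f' := stein_sol_deriv z e.
pose N := gauss_mean (ramp z e).
have cf : continuous f.
  move=> x; apply/differentiable_continuous/derivable1_diffP.
  by have [] := stein_sol_derive x th.
have mf : measurable_fun [set: R] f by exact: continuous_measurable_fun.
have mf' : measurable_fun [set: R] f'.
  apply: continuous_measurable_fun => x; apply: cvgB; last exact: cvg_cst.
  by apply: cvgD; [apply: cvgM; [exact: cvg_id|exact: cf]|exact: ch].
have [iX _ iE _] := EX.
pose g w := f' (W w).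
have mg : measurable_fun [set: T] g by exact: measurableT_comp.
have g2 w : `|g w| <= 2 by exact: stein_sol_deriv_bound.
have igX := integrable_bounded mg g2 iX.
have i1 : P.-integrable [set: T] (EFin \o cst 1) by exact: finite_measure_integrable_cst.
have ig : P.-integrable [set: T] (EFin \o g).
  have := integrable_bounded mg g2 i1.
  by apply: eq_integrable => // w _; rewrite /= mulr1.
pose Rem w := G w * (f (W' w) - f (W w) - D w * g w).
have mRem : measurable_fun [set: T] Rem.
  apply: measurable_funM => //; apply: measurable_funB.
    by apply: measurable_funB; exact: measurableT_comp.
  exact: measurable_funM.
have Rem_le w : `|Rem w| <= 2 * stein_const * ((1 + `|W w|) * (`|G w| * D w ^+ 2))
    + `|G w| * clipped_move z e `|D w| (W w).
  rewrite normrM; apply: (le_trans (ler_wpM2l _ (stein_remainder z e0 _ _))) => //.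
  by rewrite mulrDr lerD2r -/(D w) le_eqVlt; apply/orP; left; apply/eqP; ring.
have ibnd := integrableRD (integrableRZ (2 * stein_const) int3) integrable_clipped.
have iRem : P.-integrable [set: T] (EFin \o Rem).
  apply: le_integrable ibnd => //; first exact/measurable_EFinP.
  by move=> w _; rewrite /= lee_fin (le_trans (Rem_le w))// ler_norm.
pose A w := G w * f (W' w) - G w * f (W w).
have AE w : A w = g w - g w * (1 - G w * D w) + Rem w.
  by rewrite /A /Rem; ring.
have iA : P.-integrable [set: T] (EFin \o A).
  have := integrableRD (integrableRB ig igX) iRem.
  by apply: eq_integrable => // w _; rewrite /= AE.
have mWf : measurable_fun [set: T] (fun w => W w * f (W w)).
  by apply: measurable_funM => //; exact: measurableT_comp.
have iWf : P.-integrable [set: T] (EFin \o (fun w => W w * f (W w))).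
  apply: le_integrable i1 => //; first exact/measurable_EFinP.
  by move=> w _; rewrite /= lee_fin normr1 stein_sol_mulx.
have coup : (\int[P]_w A w = \int[P]_w (W w * f (W w)))%R.
  by have := WG mf iA iWf; rewrite unlock /Rintegral => ->.
have ih : P.-integrable [set: T] (EFin \o (fun w => ramp z e (W w))).
  have mhW : measurable_fun [set: T] (fun w => ramp z e (W w)).
    by apply: measurableT_comp => //; exact: continuous_measurable_fun.
  apply: le_integrable i1 => //; first exact/measurable_EFinP.
  by move=> w _; rewrite /= lee_fin normr1 ger0_norm ?ramp_ge0// ramp_le1.
have iN : P.-integrable [set: T] (EFin \o cst N) by exact: finite_measure_integrable_cst.
have E1 : (\int[P]_w ramp z e (W w))%R - N =
    (\int[P]_w (g w * (1 - G w * D w)) - \int[P]_w Rem w)%R.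
  have EN : (\int[P]_w (cst N w))%R = N.
    have : fine (\int[P]_w (cst N%:E w))%E = N.
      by rewrite integral_cst//= probability_setT mule1.
    exact.
  rewrite -[in LHS]EN.
  rewrite -[LHS]RintegralB// -[RHS]RintegralB//.
  transitivity (\int[P]_w (g w - W w * f (W w)))%R.
    by apply: eq_Rintegral => w _; rewrite /g /f' /stein_sol_deriv -/f -/N/=; ring.
  rewrite [LHS]RintegralB// -coup -[LHS]RintegralB//.
  by apply: eq_Rintegral => w _; rewrite AE; ring.
rewrite -/N E1 -addrA (le_trans (ler_normB _ _))//; apply: lerD.
  rewrite (cond_expectation_pull_out mW EX mf' (M := 2)); last first.
    by move=> x; exact: stein_sol_deriv_bound.
  have igE := integrable_bounded mg g2 iE.
  apply: (le_trans (le_normr_Rintegral measurableT igE)).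
  have iEn : P.-integrable [set: T] (EFin \o (fun w => `|E w|)) by exact: integrable_norm.
  rewrite -RintegralZl//; apply: le_Rintegral => //; first exact: integrable_norm.
    exact: integrableRZ.
  by move=> w _; rewrite normrM ler_wpM2r.
apply: (le_trans (le_normr_Rintegral measurableT iRem)).
rewrite -RintegralZl// -RintegralD//; last 2 first.
- exact: integrableRZ.
- exact: integrable_clipped.
by apply: le_Rintegral => //; exact: integrable_norm.
Qed.

End stein_bound.

(** * Conditional probability of a window of random width *)

Section conditional_window.
Context d (T : measurableType d) (R : realType) (P : probability T R).
Variables (F : set (set T)) (V : T -> R) (K : T -> probability (measurableTypeR R) R).
Hypotheses (subF : sub_sigma_field F) (mV : measurable_fun [set: T] V)
  (VK : is_cond_distribution P F V K).
(** [T] with the measurable sets restricted to [F], so that measurability with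
    respect to [F] becomes measurability of functions on a type. *)
Local Notation TF := (g_sigma_algebraType F).

Lemma measurable_subfield (A : set T) : F A <-> measurable (A : set TF).
Proof. by have [sF _] := subF; rewrite measurable_g_measurableTypeE. Qed.

Lemma measurable_wrt_fun d' (T' : measurableType d') (X : T -> T') :
  measurable_wrt F X -> measurable_fun [set: TF] (X : TF -> T').
Proof.
move=> FX _ B mB; apply/measurable_subfield; apply: FX.
by exists B => //.
Qed.

Lemma measurable_fun_subfield d' (T' : measurableType d') (X : T -> T') :
  measurable_fun [set: TF] (X : TF -> T') -> measurable_fun [set: T] X.
Proof.
move=> mX _ B mB; have [_] := subF; apply; apply/measurable_subfield.
exact: mX.
Qed.

Variables (F2 : set T) (H u : T -> R) (a0 b0 s c L eta : R).
Hypotheses (FF2 : F F2)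
  (mH : measurable_fun [set: TF] (H : TF -> R)) (H0 : forall w, 0 <= H w)
  (mu_F : measurable_fun [set: TF] (u : TF -> R)) (u0 : forall w, 0 <= u w)
  (ab : a0 <= b0) (s0 : 0 <= s) (c0 : 0 <= c) (L0 : 0 <= L) (eta0 : 0 < eta)
  (KL : {ae P, forall w, F2 w -> forall x y : R, x <= y ->
     (K w `[x, y]%classic <= (c + L * (y - x))%:E)%E}).

Let mF2 : measurable F2. Proof. by have [_] := subF; apply. Qed.

(** On [level k] the size of the window is determined by [k] up to the mesh. *)
Let level (k : nat) : set T := [set w | k%:R * eta <= u w < k.+1%:R * eta].

Let Flevel k : F (level k).
Proof.
apply/measurable_subfield.
have -> : level k = u @^-1` `[k%:R * eta, k.+1%:R * eta[%classic.
  by apply/seteqP; split => w; rewrite /level /= in_itv.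
rewrite -[X in measurable X]setTI; exact: mu_F.
Qed.

Let level_triv : trivIset setT level.
Proof.
apply/trivIsetP => i j _ _ ij; apply/seteqP; split => // w [] /=.
rewrite /level /= => /andP[i1 i2] /andP[j1 j2].
have lt1 := le_lt_trans i1 j2; have lt2 := le_lt_trans j1 i2.
move: lt1 lt2; rewrite !ltr_pM2r// !ltr_nat !ltnS => le1 le2.
by move: ij; rewrite eqn_leq le1 le2.
Qed.

Let level_cover : \bigcup_k level k = setT.
Proof.
apply/seteqP; split => // w _; have ue : 0 <= u w / eta by rewrite divr_ge0// ltW.
have /andP[t1 t2] := truncn_itv ue.
by exists (Num.truncn (u w / eta)) => //; rewrite /level /= -ler_pdivlMr// -ltr_pdivrMr// t1.
Qed.

Let window (t : R) : set R := `[a0 - s * t, b0 + s * t]%classic.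

Let width w : R := c + L * (b0 - a0 + 2 * s * (u w + eta)).

Let width0 w : 0 <= width w.
Proof.
by rewrite /width addr_ge0// mulr_ge0// addr_ge0 ?subr_ge0// !mulr_ge0// addr_ge0// ltW.
Qed.

Let inwindow w : R := \1_F2 w * \1_(window (u w)) (V w).

Let mu_T : measurable_fun [set: T] u.
Proof. exact: measurable_fun_subfield. Qed.

Let m_inwindow : measurable_fun [set: T] inwindow.
Proof.
apply: measurable_funM; first exact: measurable_indic.
have msu : measurable_fun [set: T] (fun w => s * u w) by exact: measurable_funM.
by apply: measurable_indic_window => //; [exact: measurable_funB|exact: measurable_funD].
Qed.

Let m_width : measurable_fun [set: T] (fun w => \1_F2 w * width w).
Proof.
apply: measurable_funM; first exact: measurable_indic.
apply: measurable_funD => //; apply: measurable_funM => //.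
by apply: measurable_funD => //; apply: measurable_funM => //; exact: measurable_funD.
Qed.

Let inwindow0 w : 0 <= inwindow w.
Proof. by rewrite mulr_ge0// indicE. Qed.

Let F2width0 w : 0 <= \1_F2 w * width w.
Proof. by rewrite mulr_ge0// indicE. Qed.

(** On a level the window is contained in a fixed one, to whose preimage under [V]
    the conditional distribution applies; the fixed window exceeds the actual one
    by at most [s * eta] on either side. *)
Let level_bound A k : F A ->
  (\int[P]_(w in A `&` level k) (inwindow w)%:E <=
   \int[P]_(w in A `&` level k) (\1_F2 w * width w)%:E)%E.
Proof.
move=> FA; have [[_ FD FU] Fm] := subF.
have FI X Y : F X -> F Y -> F (X `&` Y).
  move=> /measurable_subfield mX /measurable_subfield mY.
  by apply/measurable_subfield; exact: measurableI.
have mAk : measurable (A `&` level k) by apply: Fm; exact: FI.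
pose B : set R := window (k.+1%:R * eta).
have mB : measurable (B : set (measurableTypeR R)) by exact: measurable_itv.
have [mK Kint] := VK mB.
have FAF : F (A `&` level k `&` F2) by exact: (FI _ _ (FI _ _ FA (Flevel k)) FF2).
have mAF : measurable (A `&` level k `&` F2) by exact: Fm.
have mVB : measurable (V @^-1` B).
  by rewrite -[X in measurable X]setTI; exact: mV.
apply: (@le_trans _ _ (P (A `&` level k `&` F2 `&` V @^-1` B))).
  rewrite -[X in (_ <= P X)%E]setIA [X in (_ <= P X)%E]setIC.
  rewrite -integral_indic//; last exact: measurableI.
  apply: ge0_le_integral => //.
  - by move=> w _; rewrite lee_fin.
  - exact/measurable_EFinP/measurable_funTS.
  - by apply/measurable_EFinP/measurable_indic; exact: measurableI.
  - move=> w [_ /andP[_ uw]]; rewrite lee_fin /inwindow.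
    rewrite -[leRHS]/(\1_(F2 `&` V @^-1` B) w) indicI ler_wpM2l// !indicE.
    case: (boolP (V w \in window _)) => [|_//].
    rewrite inE /window/= in_itv/= => /andP[v1 v2].
    rewrite (_ : (w \in _) = true)//; apply/mem_set; rewrite /B /window/= in_itv/=.
    have su : s * u w <= s * (k.+1%:R * eta) by rewrite ler_wpM2l// ltW.
    by apply/andP; split; lra.
rewrite -Kint//.
apply: (@le_trans _ _ (\int[P]_(w in A `&` level k `&` F2) (width w)%:E)%E).
  apply: ae_ge0_le_integral => //.
  - by apply: measurable_funTS; apply: measurable_fun_subfield; exact: measurable_wrt_fun.
  - by move=> w _; rewrite lee_fin.
  - apply/measurable_EFinP/measurable_funTS.
    apply: measurable_funD => //; apply: measurable_funM => //.
    by apply: measurable_funD => //; apply: measurable_funM => //; exact: measurable_funD.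
  - have aeF : Filter (almost_everywhere P) by exact: ae_filter_ringOfSetsType.
    apply: filterS KL => w Kw [[_ /andP[uw _]] F2w].
    have ke0 : 0 <= k.+1%:R * eta by rewrite mulr_ge0// ltW.
    have ske0 := mulr_ge0 s0 ke0.
    apply: le_trans (Kw F2w (a0 - s * (k.+1%:R * eta)) (b0 + s * (k.+1%:R * eta)) _) _.
      by rewrite lerBlDr -addrA (le_trans ab)// lerDl addr_ge0.
    rewrite lee_fin /width lerD2l ler_wpM2l//.
    have : s * (k.+1%:R * eta) <= s * (u w + eta).
      by rewrite ler_wpM2l// -natr1 mulrDl mul1r lerD2r.
    move: (s * (_ * _)) => q sq; rewrite -mulrA; move: (s * _) sq => q' sq.
    lra.
rewrite integral_mkcondr; apply: ge0_le_integral => //.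
- by move=> w _; rewrite patchE; case: ifP => //; rewrite lee_fin.
- apply: measurable_funTS; apply/(measurable_restrictT _ _).1 => //.
  apply/measurable_EFinP/measurable_funTS.
  apply: measurable_funD => //; apply: measurable_funM => //.
  by apply: measurable_funD => //; apply: measurable_funM => //; exact: measurable_funD.
- exact/measurable_EFinP/measurable_funTS.
- by move=> w _; rewrite patchE indicE; case: ifP; rewrite lee_fin ?mul1r ?mul0r.
Qed.

(** The conditional distribution [K] describes [V] on fixed sets only, while the
    half-width of the window depends on the outcome.  As it is known given [F],
    the events may be cut along its levels; a mesh [eta] of the order of the
    window's own length costs only a constant factor, so that no limit is needed.
    The weight [H] then comes from [ge0_le_integral_weight]. *)
Lemma conditional_window_bound :
  (\int[P]_w (H w * (\1_F2 w * \1_`[(a0 - s * u w), (b0 + s * u w)] (V w)))%:E <=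
   \int[P]_w (H w * (\1_F2 w * (c + L * (b0 - a0 + 2 * s * (u w + eta)))))%:E)%E.
Proof.
have [_ Fm] := subF.
have mid : measurable_fun [set: T] (id : T -> TF).
  move=> _ B mB; rewrite setTI; apply: Fm; exact/measurable_subfield.
under eq_integral do rewrite EFinM.
under [leRHS]eq_integral do rewrite EFinM.
apply: (@ge0_le_integral_weight _ _ _ _ _ P (id : T -> TF) mid inwindow
  (fun w => \1_F2 w * width w) H) => //.
move=> A0 /measurable_subfield; rewrite preimage_id.
pose A : set T := A0; rewrite -/A => FA.
have -> : A = \bigcup_k (A `&` level k) by rewrite -setI_bigcupr level_cover setIT.
have mAk k : measurable (A `&` level k).
  by apply: Fm; apply/measurable_subfield; apply: measurableI; exact/measurable_subfield.
have tAk : trivIset setT (fun k => A `&` level k) by exact: trivIset_setIl.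
rewrite ge0_integral_bigcup//; last 2 first.
- exact/measurable_EFinP/measurable_funTS.
- by move=> w _; rewrite lee_fin.
rewrite ge0_integral_bigcup//; last 2 first.
- exact/measurable_EFinP/measurable_funTS.
- by move=> w _; rewrite lee_fin.
apply: lee_nneseries => k _; last exact: level_bound.
by move=> _; apply: integral_ge0 => w _; rewrite lee_fin.
Qed.

End conditional_window.

(** * One step of the induction *)

Lemma integral_lincomb_le d (T : measurableType d) (R : realType)
    (P : {measure set T -> \bar R}) (f g : T -> R) (x y a b : R) :
  measurable_fun [set: T] f -> (forall w, 0 <= f w) ->
  measurable_fun [set: T] g -> (forall w, 0 <= g w) -> 0 <= x -> 0 <= y ->
  (\int[P]_w (f w)%:E <= a%:E)%E -> (\int[P]_w (g w)%:E <= b%:E)%E ->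
  (\int[P]_w (x * f w + y * g w)%:E <= (x * a + y * b)%:E)%E.
Proof.
move=> mf f0 mg g0 x0 y0 fa gb.
under eq_integral do rewrite EFinD !EFinM.
rewrite ge0_integralD//; last 4 first.
- by move=> w _; rewrite -EFinM lee_fin mulr_ge0.
- by apply/measurable_EFinP; exact: measurable_funM.
- by move=> w _; rewrite -EFinM lee_fin mulr_ge0.
- by apply/measurable_EFinP; exact: measurable_funM.
rewrite !ge0_integralZl_EFin//; do ?exact/measurable_EFinP.
- by rewrite EFinD !EFinM; apply: leeD; rewrite lee_wpmul2l.
- by move=> w _; rewrite lee_fin.
- by move=> w _; rewrite lee_fin.
Qed.

Section kolmogorov_step.
Context d (T : measurableType d) (R : realType) (P : probability T R).
Variables (Y W W' G E Gbar Dbar Bbar V : T -> R) (m sigma : R).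
Variables (F : set (set T)) (F1 F2 : set T)
  (K : T -> probability (measurableTypeR R) R).
Hypotheses (mW : measurable_fun [set: T] W) (mW' : measurable_fun [set: T] W')
  (mG : measurable_fun [set: T] G) (mV : measurable_fun [set: T] V).
Hypotheses (sigma0 : 0 < sigma) (WY : forall w, W w = (Y w - m) / sigma).
Let D w := W' w - W w.
Hypothesis WG : stein_coupling P W W' G.
Hypothesis EX : is_cond_expectation P (g_sigma_algebra_preimage W)
  (fun w => 1 - G w * D w) E.
Hypotheses (subF : sub_sigma_field F) (FGbar : measurable_wrt F Gbar)
  (FDbar : measurable_wrt F Dbar) (FBbar : measurable_wrt F Bbar)
  (Gbar0 : forall w, 0 <= Gbar w) (Bbar0 : forall w, 0 <= Bbar w)
  (mF1 : measurable F1) (FF2 : F F2)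
  (F1GD : forall w, F1 w -> `|G w| <= Gbar w /\ `|D w| <= Dbar w)
  (F1B : forall w, F1 w -> sigma^-1 * `|Y w - V w| <= Bbar w)
  (VK : is_cond_distribution P F V K).
Variables (c L : R).
Hypotheses (c0 : 0 <= c) (L0 : 0 <= L).
(** Supplied by the induction: [c] comes from the Kolmogorov distance at the random
    parameter, [L] from the ratio of the standard deviations. *)
Hypothesis KL : {ae P, forall w, F2 w -> forall x y : R, x <= y ->
     (K w `[x, y]%classic <= (c + L / sigma * (y - x))%:E)%E}.
Variables (a1 a2 a3 b1 b2 b3 : R).
Hypotheses
  (hE : (\int[P]_w (`|E w|)%:E <= a1%:E)%E)
  (hGD : (\int[P]_w ((1 + `|W w|) * (`|G w| * D w ^+ 2))%:E <= a2%:E)%E)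
  (hbar : (\int[P]_w (Gbar w * Dbar w ^+ 2)%:E <= a3%:E)%E)
  (hF1 : (\int[P]_w (`|G w| * D w ^+ 2 * (1 - \1_F1 w))%:E <= b1%:E)%E)
  (hF2 : (\int[P]_w (`|G w| * D w ^+ 2 * (1 - \1_F2 w))%:E <= b2%:E)%E)
  (hbarB : (\int[P]_w (Gbar w * Dbar w ^+ 2 * Bbar w * \1_F2 w)%:E <= b3%:E)%E).

Let mF2 : measurable F2. Proof. by have [_] := subF; apply. Qed.
Let mGbar : measurable_fun [set: T] Gbar.
Proof. by apply: (measurable_fun_subfield subF); exact: measurable_wrt_fun. Qed.
Let mDbar : measurable_fun [set: T] Dbar.
Proof. by apply: (measurable_fun_subfield subF); exact: measurable_wrt_fun. Qed.
Let mBbar : measurable_fun [set: T] Bbar.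
Proof. by apply: (measurable_fun_subfield subF); exact: measurable_wrt_fun. Qed.
Let mD : measurable_fun [set: T] D.
Proof. exact: measurable_funB. Qed.

Section window.
Variables (z e : R) (e0 : 0 < e).

Let clip (x : R) : R := `|x| * Num.min 1 (`|x| / e).
Let u w : R := `|Dbar w| + Bbar w.
Let inwindow w : R :=
  \1_F2 w * \1_`[m + sigma * z - sigma * u w, m + sigma * (z + e) + sigma * u w] (V w).

Let clip0 x : 0 <= clip x.
Proof. by rewrite mulr_ge0// le_min ler01/= divr_ge0// ltW. Qed.

Let clip_sqr x : clip x <= x ^+ 2 / e.
Proof.
by rewrite -(real_normK (num_real x)) expr2 -mulrA ler_wpM2l// ge_min lexx orbT.
Qed.

Let clip_abs x : clip x <= `|x|.
Proof. by rewrite ler_piMr// ge_min lexx. Qed.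

Let clip_homo x y : `|x| <= `|y| -> clip x <= clip y.
Proof.
move=> xy; apply: ler_pM => //; first by rewrite le_min ler01/= divr_ge0// ltW.
by rewrite le_min !ge_min lexx/= ler_pM2r ?invr_gt0// xy orbT.
Qed.

(** [Y] and [V] differ by at most [sigma * Bbar] on [F1], and [Dbar] dominates
    [|D|] there. *)
Let window_transfer w : F1 w -> F2 w ->
  W w \in `[z - `|D w|, z + e + `|D w|] -> inwindow w = 1.
Proof.
move=> F1w F2w; rewrite in_itv/= => /andP[w1 w2].
have [_ Dw] := F1GD F1w; have := F1B F1w.
rewrite mulrC ler_pdivrMr// ler_norml => /andP[v1 v2].
have Yw : Y w = m + sigma * W w by rewrite WY mulrC divfK ?gt_eqF//; ring.
have Du : `|D w| + Bbar w <= u w by rewrite /u lerD2r (le_trans Dw)// ler_norm.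
rewrite /inwindow indicE mem_set// mul1r indicE mem_set//= in_itv/=.
have s1 : sigma * (z - `|D w|) <= sigma * W w by rewrite ler_pM2l.
have s2 : sigma * W w <= sigma * (z + e + `|D w|) by rewrite ler_pM2l.
have s3 : sigma * (`|D w| + Bbar w) <= sigma * u w by rewrite ler_pM2l.
by apply/andP; split; lra.
Qed.

(** Off the good events the crude bound [D ^+ 2 / e] is used; on them everything
    is replaced by a quantity known given [F], except [V]. *)
Let pointwise w : `|G w| * clipped_move z e `|D w| (W w) <=
  e^-1 * (`|G w| * D w ^+ 2 * (1 - \1_F1 w)) +
  e^-1 * (`|G w| * D w ^+ 2 * (1 - \1_F2 w)) +
  Gbar w * clip (Dbar w) * inwindow w.
Proof.
have /andP[cm0 cmle] := clipped_move_le z e0 (W w) (normr_ge0 (D w)).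
have eV0 : 0 <= e^-1 by rewrite invr_ge0 ltW.
have q0 : 0 <= `|G w| * D w ^+ 2 by rewrite mulr_ge0 ?sqr_ge0.
have h1 : `|G w| * clipped_move z e `|D w| (W w) <= e^-1 * (`|G w| * D w ^+ 2).
  rewrite [leRHS]mulrCA ler_wpM2l// [leRHS]mulrC (le_trans cmle)//.
  by rewrite real_normK ?num_real.
have t3 : 0 <= Gbar w * clip (Dbar w) * inwindow w.
  by apply: mulr_ge0; [exact: mulr_ge0|rewrite /inwindow !indicE mulr_ge0].
have I0 (A : set T) : 0 <= 1 - \1_A w :> R.
  by rewrite indicE; case: (_ \in _); rewrite ?subrr ?subr0.
have tA (A : set T) : 0 <= e^-1 * (`|G w| * D w ^+ 2 * (1 - \1_A w)).
  by rewrite mulr_ge0// mulr_ge0.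
have [F1w|F1w] := pselect (F1 w); last first.
  rewrite [in X in X + _ + _]indicE memNset// subr0 mulr1.
  by rewrite -addrA (le_trans h1)// lerDl addr_ge0.
have [F2w|F2w] := pselect (F2 w); last first.
  rewrite [in X in _ + X + _]indicE memNset// subr0 mulr1.
  by rewrite addrAC (le_trans h1)// lerDr addr_ge0.
apply: (@le_trans _ _ (Gbar w * clip (Dbar w) * inwindow w)); last first.
  by rewrite lerDr addr_ge0.
have [F1G F1D] := F1GD F1w.
rewrite /clipped_move; case: (boolP (W w \in `[z - `|D w|, z + e + `|D w|])) => [Wi|Wni].
  rewrite (window_transfer F1w F2w Wi) mulr1 indicE mem_set// mulr1.
  apply: ler_pM => //; first by have := clip0 (D w); rewrite /clip.
  have := @clip_homo (D w) (Dbar w); rewrite /clip; apply.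
  exact: le_trans F1D (ler_norm _).
by rewrite [X in _ * (_ * X)]indicE memNset ?mulr0//; apply/negP.
Qed.

(** The window has length [e] plus multiples of [|Dbar|], [Bbar] and the mesh [e].
    The factor [clip Dbar] is at most [Dbar ^+ 2 / e], used against [c], [e] and
    [Bbar], and also at most [|Dbar|], used against [|Dbar|]: this is how a third
    power of [Dbar] is avoided. *)
Let window_expectation :
  (\int[P]_w (Gbar w * clip (Dbar w) * inwindow w)%:E <=
    ((c / e + 5 * L) * a3 + 2 * L / e * b3)%:E)%E.
Proof.
have mclip : measurable_fun [set: R] clip.
  apply: measurable_funM; first exact: normr_measurable.
  by apply: measurable_minr => //; apply: measurable_funM.
have mGF := measurable_wrt_fun subF FGbar.
have mDF := measurable_wrt_fun subF FDbar.
have mBF := measurable_wrt_fun subF FBbar.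
have mHF : measurable_fun [set: g_sigma_algebraType F]
    ((fun w => Gbar w * clip (Dbar w)) : g_sigma_algebraType F -> R).
  by apply: measurable_funM => //; exact: measurableT_comp.
have muF : measurable_fun [set: g_sigma_algebraType F] (u : g_sigma_algebraType F -> R).
  by apply: measurable_funD => //; exact: measurableT_comp.
have H0 w : 0 <= Gbar w * clip (Dbar w) by rewrite mulr_ge0.
have u0 w : 0 <= u w by rewrite addr_ge0.
have ab : m + sigma * z <= m + sigma * (z + e).
  by rewrite lerD2l ler_pM2l// lerDl ltW.
have Ls0 : 0 <= L / sigma by rewrite divr_ge0// ltW.
apply: (le_trans (conditional_window_bound subF mV VK FF2 mHF H0 muF u0 ab
  (ltW sigma0) c0 Ls0 e0 KL)).
have A0 w : 0 <= Gbar w * Dbar w ^+ 2 by rewrite mulr_ge0 ?sqr_ge0.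
have B0 w : 0 <= Gbar w * Dbar w ^+ 2 * Bbar w * \1_F2 w.
  by apply: mulr_ge0; [exact: mulr_ge0|rewrite indicE].
have mA : measurable_fun [set: T] (fun w => Gbar w * Dbar w ^+ 2).
  by apply: measurable_funM => //; exact: measurable_funX.
have mB : measurable_fun [set: T] (fun w => Gbar w * Dbar w ^+ 2 * Bbar w * \1_F2 w).
  by apply: measurable_funM; [exact: measurable_funM|exact: measurable_indic].
have k1 : 0 <= c / e + 5 * L by rewrite addr_ge0 ?mulr_ge0 ?invr_ge0 ?(ltW e0).
have k2 : 0 <= 2 * L / e by rewrite ?mulr_ge0 ?invr_ge0 ?(ltW e0).
apply: (@le_trans _ _ (\int[P]_w ((c / e + 5 * L) * (Gbar w * Dbar w ^+ 2) +
    2 * L / e * (Gbar w * Dbar w ^+ 2 * Bbar w * \1_F2 w))%:E)%E).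
  apply: ge0_le_integral => //.
  - move=> w _; rewrite lee_fin mulr_ge0// mulr_ge0 ?indicE// addr_ge0//.
    rewrite mulr_ge0// addr_ge0// ?subr_ge0// mulr_ge0 ?mulr_ge0 ?(ltW sigma0)//.
    by rewrite addr_ge0// ltW.
  - apply/measurable_EFinP; apply: measurable_funM.
      by apply: measurable_funM => //; exact: measurableT_comp.
    apply: measurable_funM; first exact: measurable_indic.
    apply: measurable_funD => //; apply: measurable_funM => //.
    apply: measurable_funD => //; apply: measurable_funM => //.
    apply: measurable_funD => //; apply: measurable_funD => //.
    exact: measurableT_comp.
  - by apply/measurable_EFinP; apply: measurable_funD; exact: measurable_funM.
  - move=> w _; rewrite lee_fin.
    have -> : c + L / sigma * (m + sigma * (z + e) - (m + sigma * z) +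
        2 * sigma * (u w + e)) = c + 3 * L * e + 2 * L * `|Dbar w| + 2 * L * Bbar w.
      by rewrite /u; field; rewrite gt_eqF.
    rewrite indicE; case: (w \in F2); last first.
      by rewrite mul0r !mulr0 addr0 mulr_ge0.
    rewrite mul1r mulr1.
    have g0 := Gbar0 w; have B0' := Bbar0 w.
    have cs := clip_sqr (Dbar w); have ca := clip_abs (Dbar w); have cl0 := clip0 (Dbar w).
    have dd : `|Dbar w| * `|Dbar w| = Dbar w ^+ 2.
      by rewrite -expr2 real_normK ?num_real.
    have e1 : clip (Dbar w) * (c + 3 * L * e) <= Dbar w ^+ 2 * (c / e + 3 * L).
      have -> : Dbar w ^+ 2 * (c / e + 3 * L) = Dbar w ^+ 2 / e * (c + 3 * L * e).
        by field; rewrite gt_eqF.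
      by rewrite ler_wpM2r// addr_ge0// !mulr_ge0// ltW.
    have e2 : clip (Dbar w) * (2 * L * `|Dbar w|) <= 2 * L * Dbar w ^+ 2.
      have -> : clip (Dbar w) * (2 * L * `|Dbar w|) =
        2 * L * (`|Dbar w| * clip (Dbar w)) by ring.
      by rewrite -dd ler_wpM2l// ?ler_wpM2l// mulr_ge0.
    have e3 : clip (Dbar w) * (2 * L * Bbar w) <= 2 * L / e * (Dbar w ^+ 2 * Bbar w).
      rewrite [leRHS](_ : _ = Dbar w ^+ 2 / e * (2 * L * Bbar w)); last by ring.
      by rewrite ler_wpM2r// !mulr_ge0.
    rewrite -mulrA.
    have -> : (c / e + 5 * L) * (Gbar w * Dbar w ^+ 2) +
       2 * L / e * (Gbar w * Dbar w ^+ 2 * Bbar w) =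
       Gbar w * (Dbar w ^+ 2 * (c / e + 3 * L) + 2 * L * Dbar w ^+ 2 +
         2 * L / e * (Dbar w ^+ 2 * Bbar w)) by ring.
    by rewrite ler_wpM2l// !mulrDr; rewrite mulrDr in e1; lra.
exact: integral_lincomb_le.
Qed.

Lemma clipped_expectation_bound : P.-integrable [set: T]
    (EFin \o (fun w => `|G w| * clipped_move z e `|D w| (W w))) ->
  (\int[P]_w (`|G w| * clipped_move z e `|D w| (W w)))%R <=
  (b1 + b2) / e + ((c / e + 5 * L) * a3 + 2 * L / e * b3).
Proof.
move=> ic; rewrite -lee_fin fineK; last exact: integrable_fin_num ic.
have eV0 : 0 <= e^-1 by rewrite invr_ge0 ltW.
have I0 (A : set T) w : 0 <= 1 - \1_A w :> R.
  by rewrite indicE; case: (_ \in _); rewrite ?subrr ?subr0.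
have mGD : measurable_fun [set: T] (fun w => `|G w| * D w ^+ 2).
  by apply: measurable_funM; [exact: measurableT_comp|exact: measurable_funX].
have GD0 w : 0 <= `|G w| * D w ^+ 2 by rewrite mulr_ge0 ?sqr_ge0.
have tA (A : set T) w : 0 <= `|G w| * D w ^+ 2 * (1 - \1_A w) by rewrite mulr_ge0.
have mGDI (A : set T) : measurable A ->
    measurable_fun [set: T] (fun w => `|G w| * D w ^+ 2 * (1 - \1_A w)).
  move=> mA; apply: measurable_funM => //.
  by apply: measurable_funB => //; exact: measurable_indic.
have t3 w : 0 <= Gbar w * clip (Dbar w) * inwindow w.
  by apply: mulr_ge0; [exact: mulr_ge0|rewrite /inwindow !indicE mulr_ge0].
have mu_ : measurable_fun [set: T] u by apply: measurable_funD => //; exact: measurableT_comp.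
have m3 : measurable_fun [set: T] (fun w => Gbar w * clip (Dbar w) * inwindow w).
  apply: measurable_funM.
    apply: measurable_funM => //; apply: measurable_funM; first exact: measurableT_comp.
    by apply: measurable_minr => //; apply: measurable_funM => //; exact: measurableT_comp.
  apply: measurable_funM; first exact: measurable_indic.
  have mu__ : measurable_fun [set: T] (fun w => sigma * u w) by exact: measurable_funM.
  by apply: measurable_indic_window => //; [exact: measurable_funB|exact: measurable_funD].
have step := integral_lincomb_le (mGDI _ mF1) (tA F1) (mGDI _ mF2) (tA F2) eV0 eV0 hF1 hF2.
have m12 : measurable_fun [set: T] (fun w => e^-1 * (`|G w| * D w ^+ 2 * (1 - \1_F1 w)) +
    e^-1 * (`|G w| * D w ^+ 2 * (1 - \1_F2 w))).
  by apply: measurable_funD; apply: measurable_funM => //; exact: mGDI.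
have t12 w : 0 <= e^-1 * (`|G w| * D w ^+ 2 * (1 - \1_F1 w)) +
    e^-1 * (`|G w| * D w ^+ 2 * (1 - \1_F2 w)).
  by rewrite addr_ge0// mulr_ge0.
have := integral_lincomb_le m12 t12 m3 t3 ler01 ler01 step window_expectation.
rewrite !mul1r -mulrDr [_^-1 * _]mulrC; apply: le_trans.
apply: ge0_le_integral => //.
- move=> w _; rewrite lee_fin mulr_ge0//.
  by have /andP[] := clipped_move_le z e0 (W w) (normr_ge0 (D w)).
- by have /integrableP[] := ic.
- apply/measurable_EFinP; apply: measurable_funD; exact: measurable_funM.
- by move=> w _; rewrite lee_fin !mul1r pointwise.
Qed.

End window.

Let int3 : P.-integrable [set: T]
  (EFin \o (fun w => (1 + `|W w|) * (`|G w| * D w ^+ 2))).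
Proof.
have m3 : measurable_fun [set: T] (fun w => (1 + `|W w|) * (`|G w| * D w ^+ 2)).
  apply: measurable_funM.
    by apply: measurable_funD => //; exact: measurableT_comp.
  by apply: measurable_funM; [exact: measurableT_comp|exact: measurable_funX].
apply/integrableP; split; first exact/measurable_EFinP.
apply: le_lt_trans (ltry a2); apply: le_trans hGD.
apply: ge0_le_integral => //.
- by apply/measurableT_comp => //; exact/measurable_EFinP.
- exact/measurable_EFinP.
- move=> w _; rewrite /= lee_fin ger0_norm// mulr_ge0 ?addr_ge0//.
  by rewrite mulr_ge0 ?sqr_ge0.
Qed.

Let fine_integral_le (f : T -> R) (a : R) : measurable_fun [set: T] f ->
  (forall w, 0 <= f w) -> (\int[P]_w (f w)%:E <= a%:E)%E -> (\int[P]_w f w)%R <= a.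
Proof.
move=> mf f0 fa; rewrite -lee_fin fineK//.
rewrite ge0_fin_numE; first exact: le_lt_trans fa (ltry a).
by apply: integral_ge0 => w _; rewrite lee_fin.
Qed.

Let smooth_error (e : R) : R := 2 * a1 + 2 * stein_const * a2 +
   ((b1 + b2) / e + ((c / e + 5 * L) * a3 + 2 * L / e * b3)).

Let smooth_bound (z e : R) : 0 < e ->
  `|(\int[P]_w ramp z e (W w))%R - gauss_mean (ramp z e)| <= smooth_error e.
Proof.
move=> e0; have [_ _ iE _] := EX.
apply: (le_trans (stein_ramp_bound z mW mW' mG e0 WG EX int3)).
apply: lerD; last first.
  by apply: clipped_expectation_bound => //; exact: integrable_clipped.
have mE := integrable_measurable iE.
have sc0 : 0 <= 2 * stein_const :> R.
  by rewrite mulr_ge0// (le_trans ler01)// stein_const_ge1.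
apply: lerD; rewrite ler_wpM2l//; apply: fine_integral_le => //.
- exact: measurableT_comp.
- by have := integrable_measurable int3.
- by move=> w; apply: mulr_ge0; [rewrite addr_ge0|rewrite mulr_ge0 ?sqr_ge0].
Qed.

Let prob_le (z : R) : (\int[P]_w \1_[set w | W w <= z] w)%R = fine (P [set w | W w <= z]).
Proof.
by rewrite /Rintegral integral_indic ?setIT//; exact: measurable_sublevel.
Qed.

(** The indicator of [W <= z] lies between the ramps that start at [z - e] and at
    [z], whose Gaussian means differ from [gauss_cdf z] by at most [e]. *)
Lemma kolmogorov_one_step (z e : R) : 0 < e ->
  `|fine (P [set w | W w <= z]) - gauss_cdf z| <= e + smooth_error e.
Proof.
move=> e0.
have i1 : P.-integrable [set: T] (EFin \o cst 1) by exact: finite_measure_integrable_cst.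
have iI : P.-integrable [set: T] (EFin \o \1_[set w | W w <= z]).
  by apply: integrable_indic => //; exact: measurable_sublevel.
have ih y : P.-integrable [set: T] (EFin \o (fun w => ramp y e (W w))).
  have mhW : measurable_fun [set: T] (fun w => ramp y e (W w)).
    apply: measurableT_comp => //; apply: continuous_measurable_fun.
    by have [] := test_fun_ramp y e.
  apply: le_integrable i1 => //; first exact/measurable_EFinP.
  by move=> w _; rewrite /= lee_fin normr1 ger0_norm ?ramp_ge0// ramp_le1.
have up : fine (P [set w | W w <= z]) <= (\int[P]_w ramp z e (W w))%R.
  rewrite -prob_le; apply: le_Rintegral => //.
  move=> w _; rewrite indicE; have [wz|wz] := leP (W w) z.
    by rewrite ramp_eq1// lern1 leq_b1.
  by rewrite memNset ?ramp_ge0//= leNgt wz.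
have lo : (\int[P]_w ramp (z - e) e (W w))%R <= fine (P [set w | W w <= z]).
  rewrite -prob_le; apply: le_Rintegral => //.
  move=> w _; rewrite indicE; have [wz|wz] := leP (W w) z.
    by rewrite mem_set ?ramp_le1.
  by rewrite ramp_eq0// subrK ltW.
have := smooth_bound z e0; have := smooth_bound (z - e) e0.
have /andP[_ g1] := gauss_mean_ramp z e0.
have /andP[g2 _] := gauss_mean_ramp (z - e) e0.
have := gauss_cdf_lipschitz z e0; have := gauss_cdf_lipschitz (z - e) e0.
rewrite subrK => g3 g4; rewrite !ler_norml => /andP[s1 s2] /andP[s3 s4].
apply/andP; split; lra.
Qed.

End kolmogorov_step.

(** * Suprema, essential suprema and the bootstrap *)

(** The event is contained in [x - eta < X <= y], whose probability is a difference
    of values of the distribution function; [eta] then tends to 0. *)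
Lemma interval_of_kolmogorov d (T : measurableType d) (R : realType)
    (Q : probability T R) (X : T -> R) (delta x y : R) :
  measurable_fun [set: T] X ->
  (forall z, `|fine (Q [set w | X w <= z]) - gauss_cdf z| <= delta) -> x <= y ->
  (Q [set w | (x <= X w <= y)%R] <= (2 * delta + (y - x))%:E)%E.
Proof.
move=> mX hX xy.
have mle z := measurable_sublevel z mX.
have mxy : measurable [set w | (x <= X w <= y)%R].
  have -> : [set w | x <= X w <= y] = X @^-1` `[x, y]%classic.
    by apply/seteqP; split => w /=; rewrite in_itv.
  by rewrite -[X in measurable X]setTI; apply: mX => //; exact: measurable_itv.
have Qfin A : measurable A -> Q A = (fine (Q A))%:E.
  by move=> mA; rewrite fineK// fin_num_measure.
rewrite (Qfin _ mxy) lee_fin; apply/ler_addgt0Pr => eta eta0.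
have : fine (Q [set w | (x <= X w <= y)%R]) + fine (Q [set w | X w <= x - eta])
    <= fine (Q [set w | X w <= y]).
  rewrite -lee_fin EFinD -!Qfin// -measureU//; last first.
    by apply/seteqP; split => // w [/= /andP[xw _] wx]; have := le_trans xw wx; lra.
  apply: le_measure; rewrite ?inE//; first exact: measurableU.
  by move=> w [/andP[]//|/= wx]; rewrite (le_trans wx)//; lra.
have := hX y; have := hX (x - eta).
have pe : 0 < y - x + eta by lra.
have := gauss_cdf_lipschitz (x - eta) pe.
have -> : x - eta + (y - x + eta) = y by ring.
by rewrite !ler_norml => g /andP[a1 a2] /andP[b1 b2]; lra.
Qed.

(** Apply the improvement to the supremum, which is finite by the a priori bound
    [m]; the conclusion no longer depends on [m]. *)
Lemma le_of_halving (R : realType) (S : set R) (C m : R) :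
  (forall x, S x -> x <= m) ->
  (forall k, (forall x, S x -> x <= k) -> forall x, S x -> x <= C + k / 2) ->
  forall x, S x -> x <= 2 * C.
Proof.
move=> Sm SC x Sx.
have hS : has_sup S by split; [exists x|exists m].
have Ssup y : S y -> y <= sup S by move=> Sy; apply: sup_upper_bound.
have : sup S <= C + sup S / 2.
  by apply: ge_sup; [exists x|move=> y; exact: SC].
by have := Ssup _ Sx; lra.
Qed.

Lemma ge0_real_bound (R : realType) (s : \bar R) :
  (s < +oo)%E -> exists2 A : R, 0 <= A & (s <= A%:E)%E.
Proof.
case: s => [x _|//|_]; last by exists 0 => //; rewrite leNye.
by exists (Num.max 0 x); rewrite ?le_max ?lexx// lee_fin le_max lexx orbT.
Qed.

Lemma fin_bound_of_sup (T : Type) (R : realType) (S : set T) (a : T -> R)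
    (f : T -> \bar R) :
  (forall t, 0 < a t) ->
  (ereal_sup [set (a t)%:E * f t | t in S] < +oo)%E ->
  exists2 A : R, 0 <= A & forall t, S t -> (f t <= (A / a t)%:E)%E.
Proof.
move=> a0; set s := ereal_sup _ => soo.
have [A A0 sA] := ge0_real_bound soo.
exists A => // t St; rewrite mulrC EFinM lee_pdivlMl//.
by apply: le_trans sA; apply: ereal_sup_ubound; exists t.
Qed.

Lemma ae_bound_of_ess_sup (T : Type) d (O : measurableType d) (R : realType)
    (P : T -> probability O R) (S : set T) (A : T -> set O) (f : T -> O -> R) :
  (ereal_sup [set ess_sup_on (P t) (A t) (f t) | t in S] < +oo)%E ->
  exists2 M : R, 0 <= M &
    forall t, S t -> {ae P t, forall w, A t w -> f t w <= M}.
Proof.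
set s := ereal_sup _ => soo.
have [M M0 sM] := ge0_real_bound soo.
exists M => // t St.
have ess : (ess_sup_on (P t) (A t) (f t) <= M%:E)%E.
  by apply: le_trans sM; apply: ereal_sup_ubound; exists t.
have aeF : Filter (almost_everywhere (P t)) by exact: ae_filter_ringOfSetsType.
have /ess_supP := ess; apply: filterS => w + Aw.
by rewrite /patch mem_set// lee_fin.
Qed.

(** * The bound at all parameters *)

Theorem theorem1p1 (R : realType) (dT dO : measure_display)
    (Theta : measurableType dT) (Omega : measurableType dO)
    (P : Theta -> probability Omega R)
    (P_kernel : forall A : set Omega, measurable A ->
       measurable_fun [set: Theta] (fun t => P t A))
    (Y : {mfun (Theta * Omega)%type >-> R})
    (Y_mean : forall t,
       (P t).-integrable [set: Omega] (fun w => (Y (t, w))%:E))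
    (Y_var : forall t, ('V_(P t)[(fun w => Y (t, w))] < +oo)%E)
    (r : {mfun Theta >-> R}) (rbar : R)
    (W' G Gbar Dbar V Bbar : {mfun (Theta * Omega)%type >-> R})
    (Psi : {mfun (Theta * Omega)%type >-> Theta})
    (F : Theta -> set (set Omega)) (F1 F2 : Theta -> set Omega)
    (E : Theta -> Omega -> R)
    (K : Theta -> Omega -> probability (measurableTypeR R) R) :
  let Theta0 := [set t | rbar < r t] in
  let W := standardized P Y in
  let D := fun u => W' u - W u in
  (* (G1) *)
  (forall t, 0 < r t) ->
  0 < rbar ->
  (forall t, Theta0 t -> 0 < var P Y t) ->
  (* (G2) *)
  (forall t, Theta0 t ->
     stein_coupling (P t) (fun w => W (t, w)) (fun w => W' (t, w))
       (fun w => G (t, w))) ->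
  (* (G3) *)
  (forall t, Theta0 t ->
     is_cond_expectation (P t) (g_sigma_algebra_preimage (fun w => W (t, w)))
       (fun w => 1 - G (t, w) * D (t, w)) (E t)) ->
  (ereal_sup [set (r t)%:E * 'E_(P t)[(fun w => `|E t w|)%R] | t in Theta0]
     < +oo)%E ->
  (ereal_sup [set (r t)%:E *
       'E_(P t)[(fun w =>
          (1 + `|W (t, w)|) * (`|G (t, w)| * D (t, w) ^+ 2))%R] | t in Theta0]
     < +oo)%E ->
  (* (G4) *)
  (forall t, Theta0 t -> sub_sigma_field (F t)) ->
  (forall t, Theta0 t -> measurable_wrt (F t) (fun w => Gbar (t, w))) ->
  (forall t, Theta0 t -> measurable_wrt (F t) (fun w => Dbar (t, w))) ->
  (forall t, Theta0 t -> forall w, 0 <= Gbar (t, w)) ->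
  (forall t, Theta0 t -> measurable (F1 t)) ->
  (forall t, Theta0 t -> forall w, F1 t w ->
     `|G (t, w)| <= Gbar (t, w) /\ `|D (t, w)| <= Dbar (t, w)) ->
  (ereal_sup [set (r t ^+ 2)%:E *
       'E_(P t)[(fun w =>
          `|G (t, w)| * D (t, w) ^+ 2 * (1 - \1_(F1 t) w))%R] | t in Theta0]
     < +oo)%E ->
  (ereal_sup [set (r t)%:E *
       'E_(P t)[(fun w => Gbar (t, w) * Dbar (t, w) ^+ 2)%R] | t in Theta0]
     < +oo)%E ->
  (* (G5) *)
  (forall t, Theta0 t -> measurable_wrt (F t) (fun w => Psi (t, w))) ->
  (forall t, Theta0 t -> F t (F2 t)) ->
  (forall t, Theta0 t ->
     is_cond_distribution (P t) (F t) (fun w => V (t, w)) (K t)) ->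
  (forall t, Theta0 t -> forall w, F2 t w ->
     forall B : set (measurableTypeR R), measurable B ->
       K t w B = P (Psi (t, w)) [set w' | B (Y (Psi (t, w), w'))]) ->
  (ereal_sup [set (r t ^+ 2)%:E *
       'E_(P t)[(fun w =>
          `|G (t, w)| * D (t, w) ^+ 2 * (1 - \1_(F2 t) w))%R] | t in Theta0]
     < +oo)%E ->
  (* (G6) *)
  (forall t, Theta0 t -> measurable_wrt (F t) (fun w => Bbar (t, w))) ->
  (forall t, Theta0 t -> forall w, 0 <= Bbar (t, w)) ->
  (forall t, Theta0 t -> forall w, F1 t w ->
     (sdev P Y t)^-1 * `|Y (t, w) - V (t, w)| <= Bbar (t, w)) ->
  (ereal_sup [set (r t ^+ 2)%:E *
       'E_(P t)[(fun w =>
          Gbar (t, w) * Dbar (t, w) ^+ 2 * Bbar (t, w) * \1_(F2 t) w)%R]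
     | t in Theta0] < +oo)%E ->
  (* (G7) *)
  (ereal_sup [set ess_sup_on (P t)
       (F2 t `&` [set w | Theta0 (Psi (t, w))])
       (fun w => (sdev P Y t ^+ 2 / sdev P Y (Psi (t, w)) ^+ 2)%R) | t in Theta0]
     < +oo)%E ->
  (ereal_sup [set ess_sup_on (P t) (F2 t)
       (fun w => (r t / r (Psi (t, w)))%R) | t in Theta0]
     < +oo)%E ->
  (ereal_sup [set ess_sup_on (P t)
       (F2 t `&` [set w | Theta0 (Psi (t, w))])
       (fun w => (r (Psi (t, w)) / r t)%R) | t in Theta0]
     < +oo)%E ->
  exists C : R, forall t : Theta,
    (ereal_sup [set `|P t [set w | (W (t, w) <= z)%R]
                      - normal_prob 0%R 1%R `]-oo, z]| | z in [set: R]]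
       <= (C / r t)%:E)%E.
Proof.
move=> Theta0 W D r0 rbar0 var0 WG EX hE hGD subF FGbar FDbar Gbar0 mF1 F1GD hF1 hbar
  FPsi FF2 VK KY hF2 FBbar Bbar0 F1B hbarB hvar hr _.
have [A1 A10 bE] := fin_bound_of_sup r0 hE.
have [A2 A20 bGD] := fin_bound_of_sup r0 hGD.
have [A3 A30 bbar] := fin_bound_of_sup r0 hbar.
have r20 t : 0 < r t ^+ 2 by rewrite exprn_gt0.
have [B1 B10 bF1] := fin_bound_of_sup r20 hF1.
have [B2 B20 bF2] := fin_bound_of_sup r20 hF2.
have [B3 B30 bbarB] := fin_bound_of_sup r20 hbarB.
have [M1 M10 bvar] := ae_bound_of_ess_sup hvar.
have [M2 M20 br] := ae_bound_of_ess_sup hr.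
have mpair (X : {mfun (Theta * Omega)%type >-> R}) t :
    measurable_fun [set: Omega] (fun w => X (t, w)).
  exact: measurableT_comp (pair1_measurable t).
pose sd t := sdev P Y t.
have sd0 t : Theta0 t -> 0 < sd t by move=> /var0; rewrite /sd /sdev sqrtr_gt0.
have WE t w : Theta0 t -> W (t, w) = (Y (t, w) - mean P Y t) / sd t.
  by move=> /sd0 s0; rewrite /W /standardized /= -/(sd t) s0.
have mW t : measurable_fun [set: Omega] (fun w => W (t, w)).
  rewrite /W /standardized/=; case: (0 < sdev P Y t) => //.
  by apply: measurable_funM => //; apply: measurable_funB.
have mWz t z := measurable_sublevel z (mW t).
pose q t z := `|fine (P t [set w | W (t, w) <= z]) - gauss_cdf z|.
have q1 t z : q t z <= 1.
  have p0 : 0 <= fine (P t [set w | W (t, w) <= z]) by rewrite fine_ge0.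
  have p1 : fine (P t [set w | W (t, w) <= z]) <= 1.
    by rewrite -lee_fin fineK ?probability_le1// fin_num_measure.
  have g0 : 0 <= gauss_cdf z by rewrite fine_ge0.
  have g1 : gauss_cdf z <= 1 by rewrite -lee_fin -normal_prob_fin// probability_le1.
  by rewrite /q ler_norml; apply/andP; split; lra.
pose M := 1 + M2.
pose L := 1 + M1.
(* [A] is chosen so that [2 * M * A3 / A <= 1 / 2]: this is the contraction factor. *)
pose A := 4 * M * A3 + 1.
pose C0 := A + 2 * A1 + 2 * stein_const * A2 + (B1 + B2) / A + 5 * L * A3
  + 2 * L * B3 / A + M * rbar * A3 / A.
have M_ge1 : 1 <= M by rewrite lerDl.
have L_ge1 : 1 <= L by rewrite lerDl.
have A_gt0 : 0 < A by rewrite ltr_wpDl// !mulr_ge0// (le_trans ler01).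
have M_ge0 : 0 <= M by apply: le_trans M_ge1.
have L_ge0 : 0 <= L by apply: le_trans L_ge1.
have C0_ge0 : 0 <= C0.
  have sc0 : 0 <= stein_const :> R by apply: le_trans stein_const_ge1.
  have A_ge0 := ltW A_gt0; have rbar_ge0 := ltW rbar0.
  have t1 : 0 <= (B1 + B2) / A by apply: divr_ge0 => //; exact: addr_ge0.
  have t2 : 0 <= 2 * L * B3 / A by apply: divr_ge0 => //; rewrite !mulr_ge0.
  have t3 : 0 <= M * rbar * A3 / A by apply: divr_ge0 => //; rewrite !mulr_ge0.
  have t4 : 0 <= stein_const * A2 by apply: mulr_ge0.
  have t5 : 0 <= L * A3 by apply: mulr_ge0.
  by rewrite /C0 -!mulrA; rewrite -!mulrA in t1 t2 t3; lra.
(* The truncation level [m] makes an initial bound available; [C0] does not depend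
   on it. *)
have step m k : 0 < m -> 0 <= k ->
    (forall t, Theta0 t -> forall z, Num.min (r t) m * q t z <= k) ->
    forall t, Theta0 t -> forall z, Num.min (r t) m * q t z <= C0 + k / 2.
  move=> m0 k0 hk t Tt z.
  have min0 s : 0 < Num.min (r s) m by rewrite lt_min r0.
  have st0 := sd0 t Tt.
  have rt0 := r0 t.
  (* The first summand bounds twice the distance at [Psi] when [Psi] is in
     [Theta0]; otherwise [r] is at most [rbar] there, and the second is at least 1. *)
  pose c := 2 * (k * M / Num.min (r t) m) + M * rbar / r t.
  have c0 : 0 <= c.
    rewrite addr_ge0// ?mulr_ge0 ?divr_ge0 ?mulr_ge0 ?invr_ge0//; do ?exact: ltW;
      by apply: le_trans M_ge1.
  have KL : {ae P t, forall w, F2 t w -> forall x y : R, x <= y ->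
      (K t w `[x, y]%classic <= (c + L / sd t * (y - x))%:E)%E}.
    have aeF : Filter (almost_everywhere (P t)) by exact: ae_filter_ringOfSetsType.
    have := bvar t Tt; have := br t Tt; apply: filterS2 => w hr_w hv_w F2w x y xy.
    rewrite (KY t Tt w F2w); last exact: measurable_itv.
    set p := Psi (t, w) in hr_w hv_w *.
    have rp : r t <= M * r p.
      have := hr_w F2w; rewrite ler_pdivrMr//; move/le_trans; apply.
      by apply: ler_wpM2r; [exact: ltW|rewrite lerDr].
    have [Tp|nTp] := pselect (Theta0 p).
      have sp0 := sd0 p Tp.
      have qp u : q p u <= k * M / Num.min (r t) m.
        rewrite ler_pdivlMr// mulrC.
        have minp : Num.min (r t) m <= M * Num.min (r p) m.
          rewrite minr_pMr // le_min !ge_min rp/=.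
          by rewrite ler_peMl ?orbT// ltW.
        have := ler_wpM2r (normr_ge0 _ : 0 <= q p u) minp.
        move/le_trans; apply; rewrite -mulrA mulrC ler_wpM2r ?hk//.
      have xy' : (x - mean P Y p) / sd p <= (y - mean P Y p) / sd p.
        by rewrite ler_pM2r ?invr_gt0// lerD2r.
      have := interval_of_kolmogorov (mW p) qp xy'.
      have -> : [set w0 | (x - mean P Y p) / sd p <= W (p, w0) <= (y - mean P Y p) / sd p]
          = [set w' | `[x, y]%classic (Y (p, w'))].
        apply/seteqP; split => w' /=; rewrite WE// !ler_pM2r ?invr_gt0// !lerD2r in_itv//.
      move/le_trans; apply; rewrite lee_fin -mulrBl.
      have -> : y - mean P Y p - (x - mean P Y p) = y - x by ring.
      rewrite /c -addrA lerD2l.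
      (* The ratio of standard deviations is at most 1 plus its square. *)
      have sp : (sd p)^-1 <= L / sd t.
        have := hv_w (conj F2w Tp); rewrite -/(sd t) -/(sd p) -expr_div_n => hv.
        rewrite ler_pdivlMr// mulrC.
        have := sqr_ge0 (sd t / sd p - 1); rewrite sqrrB1 /L => hs.
        have sq0 : 0 <= sd t / sd p by rewrite divr_ge0// ltW.
        nra.
      apply: (@le_trans _ _ (L / sd t * (y - x))).
        by rewrite mulrC ler_wpM2r// subr_ge0.
      by rewrite lerDr divr_ge0 ?mulr_ge0 ?(le_trans _ M_ge1)// ltW.
    apply: (@le_trans _ _ 1%E).
      apply: probability_le1.
      rewrite -[X in measurable X]setTI.
      by apply: (mpair Y p) => //; exact: measurable_itv.
    have Mr : 1 <= M * rbar / r t.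
      rewrite ler_pdivlMr// mul1r (le_trans rp)// ler_wpM2l ?(le_trans _ M_ge1)//.
      by rewrite leNgt; apply/negP.
    have l0 : 0 <= L / sd t * (y - x).
      apply: mulr_ge0; last by rewrite subr_ge0.
      by apply: divr_ge0; [apply: le_trans L_ge1|exact: ltW].
    have h0 : 0 <= k * M / Num.min (r t) m.
      by apply: divr_ge0; [exact: mulr_ge0|exact: ltW].
    by rewrite lee_fin /c; lra.
  have e0 : 0 < A / r t by rewrite divr_gt0.
  have := @kolmogorov_one_step _ Omega R (P t) (fun w => Y (t, w)) (fun w => W (t, w))
    (fun w => W' (t, w)) (fun w => G (t, w)) (E t) (fun w => Gbar (t, w))
    (fun w => Dbar (t, w)) (fun w => Bbar (t, w)) (fun w => V (t, w)) (mean P Y t) (sd t)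
    (F t) (F1 t) (F2 t) (K t) (mW t) (mpair W' t) (mpair G t) (mpair V t) st0
    (fun w => WE t w Tt) (WG t Tt) (EX t Tt) (subF t Tt) (FGbar t Tt) (FDbar t Tt)
    (FBbar t Tt) (Gbar0 t Tt) (Bbar0 t Tt) (mF1 t Tt) (FF2 t Tt) (F1GD t Tt) (F1B t Tt)
    (VK t Tt) c L c0 (le_trans ler01 L_ge1) KL (A1 / r t) (A2 / r t) (A3 / r t)
    (B1 / r t ^+ 2) (B2 / r t ^+ 2) (B3 / r t ^+ 2).
  have := bE t Tt; have := bGD t Tt; have := bbar t Tt; have := bF1 t Tt.
  have := bF2 t Tt; have := bbarB t Tt; rewrite !unlock.
  move=> h6 h5 h4 h3 h2 h1 /(_ h1 h2 h3 h4 h5 h6 z _ e0).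
  rewrite -/(q t z) => hq.
  have min_le : Num.min (r t) m <= r t by rewrite ge_min lexx.
  have mt0 := min0 t.
  have qC : q t z <= C0 / r t + 2 * M * A3 / A * (k / Num.min (r t) m).
    apply: (le_trans hq); rewrite le_eqVlt; apply/orP; left; apply/eqP.
    by rewrite /c /C0; field; rewrite !gt_eqF.
  have half : 2 * M * A3 / A <= 2^-1.
    by rewrite ler_pdivrMr// /A; lra.
  apply: (le_trans (ler_wpM2l (ltW mt0) qC)); rewrite mulrDr; apply: lerD.
    by rewrite mulrCA ler_piMr// ler_pdivrMr// mul1r.
  have -> : Num.min (r t) m * (2 * M * A3 / A * (k / Num.min (r t) m)) =
      2 * M * A3 / A * k by field; rewrite !gt_eqF.
  by rewrite [leRHS]mulrC ler_wpM2r.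
pose C := 2 * C0 + rbar.
have qC t z : q t z <= C / r t.
  have [Tt|nTt] := pselect (Theta0 t); last first.
    apply: (le_trans (q1 t z)); rewrite ler_pdivlMr// mul1r.
    have : r t <= rbar by rewrite leNgt; apply/negP.
    by rewrite /C; lra.
  rewrite ler_pdivlMr//.
  (* Truncating at [r t] loses nothing at [t] itself. *)
  pose S := [set x | exists2 s, Theta0 s & exists y, x = Num.min (r s) (r t) * q s y].
  have Sbnd x : S x -> x <= r t.
    move=> [s Ts [y ->]]; rewrite -[leRHS]mulr1.
    apply: ler_pM; [|exact: normr_ge0| |exact: q1].
      by rewrite le_min !ltW.
    by rewrite ge_min lexx orbT.
  have Sstep k : (forall x, S x -> x <= k) -> forall x, S x -> x <= C0 + k / 2.
    move=> hk x [s Ts [y ->]].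
    have k0 : 0 <= k.
      apply: le_trans (hk (Num.min (r s) (r t) * q s y) _); last first.
        by exists s => //; exists y.
      by apply: mulr_ge0; [rewrite le_min !ltW|exact: normr_ge0].
    by apply: step => // s' Ts' y'; apply: hk; exists s' => //; exists y'.
  have := le_of_halving Sbnd Sstep (x := r t * q t z).
  rewrite [q t z * _]mulrC => H; apply: (le_trans (H _)); last by rewrite /C; lra.
  by exists t => //; exists z; rewrite minxx.
exists C => t; apply: ge_ereal_sup => _ [z _ <-].
rewrite normal_prob_fin// -[X in (`|X - _|%E <= _)%E]fineK ?fin_num_measure//.
by rewrite -EFinB abse_EFin lee_fin; exact: qC.
Qed.
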